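(* Let $a>b>0$, let $\mathcal{E}:\ \frac{\mathsf{x}^2}{a}+\frac{\mathsf{y}^2}{b}=1$, and let $\mathcal{C}_{\lambda_0}$, $\lambda_0\in(0,b)\cup(b,a)$, be a conic confocal with $\mathcal{E}$. Suppose that real polynomials $\hat p_{2n}$, $\hat q_{2n-2}$ of degrees $2n$, $2n-2$ respectively ($n\ge 1$) satisfy the Pell equation $$\hat p_{2n}^2(s)-s\left(s-\frac1a\right)\left(s-\frac1b\right)\left(s-\frac1{\lambda_0}\right)\hat q_{2n-2}^2(s)=1.$$ Then there exist unique real polynomials $p_{d_1}$, $q_{d_2}$, $S'$, $S''$ of degrees $d_1$, $d_2$, $d'$, $d''$ respectively, such that either $d_1=d_2=n-1$, $d'=d''=2$, or $d_1=n$, $d_2=n-2$, $d'=0$, $d''=4$, and: - $S'$, $S''$ are monic and $S'S''=s\left(s-\frac1a\right)\left(s-\frac1b\right)\left(s-\frac1{\lambda_0}\right)$; - $S'p_{d_1}^2-S''q_{d_2}^2$ equals $1$ or $-1$. Moreover, the billiard trajectories within $\mathcal{E}$ with caustic $\mathcal{C}_{\lambda_0}$ are all $2n$-elliptic periodic. They are $2n$-periodic if and only if $S'=1$.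
   Context: The confocal family is $\mathcal{C}_{\lambda}:\ \frac{\mathsf{x}^2}{a-\lambda}+\frac{\mathsf{y}^2}{b-\lambda}=1$; $\mathcal{C}_\lambda$ is an ellipse for $\lambda<b$, a hyperbola for $\lambda\in(b,a)$, with degenerate members the $\mathsf{x}$-axis ($\lambda=b$) and the $\mathsf{y}$-axis ($\lambda=a$). Billiard trajectories within $\mathcal{E}$ are polygonal lines with vertices on $\mathcal{E}$ obeying the reflection law at each vertex; a trajectory has caustic $\mathcal{C}_{\lambda_0}$ if all lines containing its segments are tangent to $\mathcal{C}_{\lambda_0}$. A trajectory is $N$-periodic if it closes after $N$ reflections ($N$ not required to be minimal). Every point other than the foci lies on exactly two conics $\mathcal{C}_{\lambda_1},\mathcal{C}_{\lambda_2}$, $\lambda_1<\lambda_2$; $(\lambda_1,\lambda_2)$ are its elliptic coordinates. A trajectory is $N$-elliptic periodic if it is $N$-periodic in elliptic coordinates, i.e. the elliptic coordinates of the moving point along the trajectory repeat periodically after $N$ reflections.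
   Formalization: Uniqueness of p, q, S', S'' is false literally (p may be replaced by -p, q by -q; if d'=d''=2, the pairs (S',p) and (S'',q) may be exchanged), so it is asserted only up to these sign changes and this exchange. *)

(* Defs.v *)
From mathcomp Require Import all_boot all_order all_algebra.
From mathcomp Require Import reals.

Set Implicit Arguments.
Unset Strict Implicit.
Unset Printing Implicit Defensive.

Import Order.TTheory GRing.Theory Num.Theory.
Local Open Scope ring_scope.

(* In particular p != 0. *)
Definition has_degree (R : realType) (p : {poly R}) (d : nat) : Prop :=
  size p = d.+1.

Definition pell_quartic (R : realType) (a b l0 : R) : {poly R} :=
  'X * ('X - (a^-1)%:P) * ('X - (b^-1)%:P) * ('X - (l0^-1)%:P).

Definition pell_equation (R : realType) (a b l0 : R) (ph qh : {poly R}) : Prop :=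
  ph ^+ 2 - pell_quartic a b l0 * qh ^+ 2 = 1.

(* A degree n - 2 only makes sense for n >= 2, whence the guard against
   truncated subtraction. *)
Definition pell_splitting (R : realType) (a b l0 : R) (n : nat)
    (p q S1 S2 : {poly R}) : Prop :=
  [/\ [/\ has_degree p (n - 1), has_degree q (n - 1),
          has_degree S1 2 & has_degree S2 2] \/
      [/\ (2 <= n)%N, has_degree p n, has_degree q (n - 2),
          has_degree S1 0 & has_degree S2 4],
      S1 \is monic, S2 \is monic,
      S1 * S2 = pell_quartic a b l0 &
      S1 * p ^+ 2 - S2 * q ^+ 2 = 1 \/ S1 * p ^+ 2 - S2 * q ^+ 2 = -1].

(* pell_splitting is invariant under p |-> - p and q |-> - q and, when
   S1 and S2 both have degree 2, under exchanging (S1, p) and (S2, q), which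
   turns the right-hand side 1 into -1 and conversely.  A splitting can
   therefore be unique only up to these operations. *)
Definition same_splitting (R : realType) (p q S1 S2 p' q' T1 T2 : {poly R}) :
    Prop :=
  [/\ T1 = S1, T2 = S2, p' = p \/ p' = - p & q' = q \/ q' = - q] \/
  [/\ T1 = S2, T2 = S1, p' = q \/ p' = - q & q' = p \/ q' = - p].

(* The values l = a and l = b give the degenerate members, namely the y-axis
   and the x-axis. *)
Definition on_confocal (R : realType) (a b l : R) (P : R * R) : Prop :=
  if l == a then P.1 = 0
  else if l == b then P.2 = 0
  else P.1 ^+ 2 / (a - l) + P.2 ^+ 2 / (b - l) = 1.

Definition on_ellipse (R : realType) (a b : R) (P : R * R) : Prop :=
  P.1 ^+ 2 / a + P.2 ^+ 2 / b = 1.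

Definition elliptic_coordinates (R : realType) (a b : R) (P : R * R)
    (l1 l2 : R) : Prop :=
  [/\ l1 < l2, on_confocal a b l1 P & on_confocal a b l2 P].

(* The tangent to a nondegenerate C_l at its point (x : y : z), given in
   homogeneous coordinates, is X x / (a - l) + Y y / (b - l) = z; for A != B,
   the line AB is that tangent as soon as A and B satisfy this equation.  The
   case z = 0 gives the asymptotes of a hyperbola, which are tangent to it at
   infinity. *)
Definition tangent_to_confocal (R : realType) (a b l : R) (A B : R * R) : Prop :=
  exists x y z : R,
    [/\ ~ [/\ x = 0, y = 0 & z = 0],
        x ^+ 2 / (a - l) + y ^+ 2 / (b - l) = z ^+ 2,
        A.1 * x / (a - l) + A.2 * y / (b - l) = z &
        B.1 * x / (a - l) + B.2 * y / (b - l) = z].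

Definition ellipse_normal (R : realType) (a b : R) (P : R * R) : R * R :=
  (P.1 / a, P.2 / b).

Definition dot (R : realType) (u v : R * R) : R := u.1 * v.1 + u.2 * v.2.

Definition scale (R : realType) (c : R) (u : R * R) : R * R :=
  (c * u.1, c * u.2).

(* Orthogonal reflection of the vector v in the line with normal vector w. *)
Definition reflect_vector (R : realType) (w v : R * R) : R * R :=
  v - scale (2 * dot v w / dot w w) w.

Definition billiard_trajectory (R : realType) (a b : R) (X : nat -> R * R) :
    Prop :=
  [/\ forall k, on_ellipse a b (X k),
      forall k, X k.+1 <> X k &
      forall k, exists2 c : R, 0 < c &
        X k.+2 - X k.+1 =
        scale c (reflect_vector (ellipse_normal a b (X k.+1)) (X k.+1 - X k))].

Definition has_caustic (R : realType) (a b l0 : R) (X : nat -> R * R) : Prop :=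
  forall k, tangent_to_confocal a b l0 (X k) (X k.+1).

Definition periodic (R : realType) (N : nat) (X : nat -> R * R) : Prop :=
  forall k, X (k + N)%N = X k.

(* The moving point after k reflections and a fraction t of the next segment. *)
Definition moving_point (R : realType) (X : nat -> R * R) (k : nat) (t : R) :
    R * R :=
  X k + scale t (X k.+1 - X k).

Definition elliptic_periodic (R : realType) (a b : R) (N : nat)
    (X : nat -> R * R) : Prop :=
  forall (k : nat) (t : R), 0 <= t <= 1 ->
  exists l1 l2 : R,
    elliptic_coordinates a b (moving_point X k t) l1 l2 /\
    elliptic_coordinates a b (moving_point X (k + N) t) l1 l2.

(* Main.v *)
(* From f^2 - Q g^2 = 1 the coprime factors f - 1 and f + 1 are, up to
   constants, S1 p^2 and S2 q^2 with S1 S2 = Q.  Conversely a splitting gives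
   the solution (S1 p^2 + S2 q^2, 2 p q) of the Pell equation, and the solution
   of given degree is unique up to signs.

   A segment of a trajectory, leaving P in the direction w, is encoded by a
   traceless 2 x 2 matrix L(s), quadratic in s, with det L proportional to Q;
   flight and reflection conjugate L by elementary matrices, so that one bounce
   conjugates it by a matrix S(s) of degree 1 and determinant 1.  For the Pell
   solution of degree N the matrix f + g L / c has determinant 1, commutes with
   L, and splitting off the inverses of the successive S on the right lowers
   its degree by one each time.  After N bounces the constant f(0) remains, so
   f + g L / c is f(0) times the product of the S.  Evaluation at s = 1/a and
   s = 1/b shows that N bounces multiply the coordinates of the position by the
   signs f(0) f(1/a) and f(0) f(1/b).  Both are 1 exactly when 0, 1/a, 1/b are
   roots of the same factor of Q, hence, all degrees being even, when that
   factor is Q. *)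

Require Import Defs.
From mathcomp Require Import all_boot all_order all_algebra.
From mathcomp Require Import reals.
From mathcomp Require Import ring lra zify.

Set Implicit Arguments.
Unset Strict Implicit.
Unset Printing Implicit Defensive.

Import Order.TTheory GRing.Theory Num.Theory.
Local Open Scope ring_scope.

(** * Pell equations and their splittings *)

(** With g = gcd(u, h), cancelling g gives (u/g) v = g (h/g)^2. Since u/g is coprime to h/g, and g
    to v, each of u/g and g divides the other. *)
Lemma coprime_mul_square (F : fieldType) (u v h : {poly F}) :
  u != 0 -> coprimep u v -> u * v = h ^+ 2 ->
  exists2 c : F, c != 0 & exists g : {poly F}, u = c *: g ^+ 2.
Proof.
move=> u0 cuv uvh; pose g := gcdp u h.
have gu : g %| u by exact: dvdp_gcdl.
have g0 : g != 0 by apply: contraTneq gu => ->; rewrite dvd0p.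
have Eu := divpK gu; have Eh := divpK (dvdp_gcdr u h : g %| h).
have cop : coprimep (u %/ g) (h %/ g).
  by apply: coprimep_div_gcd; rewrite u0.
set u' := u %/ g in Eu cop *; set h' := h %/ g in Eh cop *.
have E : u' * v = g * h' ^+ 2.
  apply: (mulIf g0); rewrite -mulrA (mulrC v) mulrA Eu uvh -{1}Eh.
  by rewrite exprMn expr2; ring.
have u'g : u' %| g.
  rewrite -(@Gauss_dvdpl _ _ (h' ^+ 2)); last exact: coprimep_expr.
  by rewrite -E dvdp_mulr.
have gu' : g %| u'.
  rewrite -(@Gauss_dvdpl _ _ v); last exact: coprimep_dvdr cuv.
  by rewrite E dvdp_mulr.
have /eqpf_eq[c c0 Ec] : u' %= g by rewrite /eqp u'g.
by exists c => //; exists g; rewrite expr2 scalerAl -Ec Eu.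
Qed.

(** Coprimality makes S1 prime to T2 and T1 prime to S2, so equal products force S1 and T1 to divide
    each other; cancelling leaves equal squares. *)
Lemma coprime_monic_square_eq (F : fieldType) (p q S1 S2 p' q' T1 T2 : {poly F}) :
  S1 \is monic -> T1 \is monic -> S2 != 0 -> S1 * S2 = T1 * T2 ->
  coprimep (S1 * p ^+ 2) (S2 * q ^+ 2) ->
  S1 * p ^+ 2 = T1 * p' ^+ 2 -> S2 * q ^+ 2 = T2 * q' ^+ 2 ->
  [/\ T1 = S1, T2 = S2, p' = p \/ p' = - p & q' = q \/ q' = - q].
Proof.
move=> mS mT S20 EQ cop E1 E2.
have S0 := monic_neq0 mS.
have cST : coprimep S1 T2.
  apply: (@coprimep_dvdr _ (S1 * p ^+ 2)); first exact: dvdp_mulr.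
  apply: (@coprimep_dvdl _ (S2 * q ^+ 2)) => //.
  by rewrite E2; exact: dvdp_mulr.
have cTS : coprimep T1 S2.
  apply: (@coprimep_dvdr _ (S1 * p ^+ 2)); first by rewrite E1 dvdp_mulr.
  by apply: (@coprimep_dvdl _ (S2 * q ^+ 2)) => //; exact: dvdp_mulr.
have ET : T1 = S1.
  apply/eqP; rewrite -eqp_monic // /eqp.
  rewrite -(@Gauss_dvdpl _ _ S2) // EQ dvdp_mulr //=.
  by rewrite -(@Gauss_dvdpl _ _ T2) // -EQ dvdp_mulr.
have ET2 : T2 = S2 by apply: (mulfI S0); rewrite -{1}ET EQ.
have sq (A x y : {poly F}) : A != 0 -> A * x ^+ 2 = A * y ^+ 2 -> y = x \/ y = - x.
  move=> A0 /(mulfI A0)/esym/eqP; rewrite eqf_sqr => /orP[]/eqP ->; by [left|right].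
split=> //; first by apply: (sq S1) => //; rewrite E1 ET.
by apply: (sq S2) => //; rewrite E2 ET2.
Qed.

(** Eliminating D gives (f g' - f' g)(f g' + f' g) = g'^2 - g^2, of degree at most 2m. The factors
    sum to 2 f g', of degree 2m + 2, so one of them has at least that degree and the product must
    vanish. *)
Lemma pell_unique (R : idomainType) (D f g f' g' : {poly R}) (m : nat) :
  2 != 0 :> R -> size g = m.+1 -> size g' = m.+1 -> size f = m.+3 ->
  f ^+ 2 - D * g ^+ 2 = 1 -> f' ^+ 2 - D * g' ^+ 2 = 1 ->
  f' = f \/ f' = - f.
Proof.
move=> c2 sg sg' sf E E'.
have fact : (f * g' - f' * g) * (f * g' + f' * g) = g' ^+ 2 - g ^+ 2.
  have -> : (f * g' - f' * g) * (f * g' + f' * g) =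
            f ^+ 2 * g' ^+ 2 - f' ^+ 2 * g ^+ 2 by ring.
  by move/(canRL (subrK _)): E => ->; move/(canRL (subrK _)): E' => ->; ring.
have nz (p : {poly R}) k : size p = k.+1 -> p != 0.
  by move=> sp; rewrite -size_poly_eq0 sp.
have sq (p : {poly R}) k : size p = k.+1 -> (size (p ^+ 2)%R <= k.*2.+1)%N.
  by move=> sp; rewrite (leq_trans (size_poly_exp_leq _ _)) // sp /=; lia.
have big : size (f * g' *+ 2) = (m.*2 + 3)%N.
  rewrite -mulr_natl -polyC_natr mul_polyC size_scale //.
  by rewrite size_mul ?(nz _ _ sf) ?(nz _ _ sg') // sf sg' /=; lia.
have Eg : g' ^+ 2 = g ^+ 2.
  apply/eqP; rewrite -subr_eq0 -fact; apply/negPn/negP => n0.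
  have := n0; rewrite mulf_eq0 negb_or => /andP[n1 n2].
  have : (size (g' ^+ 2 - g ^+ 2)%R <= m.*2.+1)%N.
    by rewrite (leq_trans (size_polyD _ _)) // size_polyN geq_max !(sq _ m).
  rewrite -fact size_mul // => le.
  have := size_polyD (f * g' - f' * g) (f * g' + f' * g).
  have -> : (f * g' - f' * g) + (f * g' + f' * g) = f * g' *+ 2 by ring.
  move: n1 n2; rewrite big -!size_poly_gt0; lia.
have /eqP : f' ^+ 2 = f ^+ 2.
  by move/(canRL (subrK _)): E => ->; move/(canRL (subrK _)): E' => ->; rewrite Eg.
by rewrite eqf_sqr => /orP[]/eqP ->; [left|right].
Qed.

Lemma lead_coefD_gt0 (R : numDomainType) (f g : {poly R}) :
  size f = size g -> 0 < lead_coef f -> 0 < lead_coef g ->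
  size (f + g) = size f /\ 0 < lead_coef (f + g).
Proof.
move=> sfg lf lg.
have pos : 0 < (f + g)`_(size f).-1.
  by rewrite coefD; apply: addr_gt0 => //; rewrite sfg.
have sz : size (f + g) = size f.
  apply/eqP; rewrite eqn_leq (leq_trans (size_polyD _ _)) ?sfg ?maxnn //=.
  rewrite -sfg leqNgt; apply/negP => lt.
  have : (f + g)`_(size f).-1 = 0 by apply: nth_default; move: lt; case: (size f).
  by move=> E; rewrite E ltxx in pos.
by split=> //; rewrite lead_coefE sz.
Qed.

Lemma coprimep_subC (F : fieldType) (f g : {poly F}) (c : F) :
  c != 0 -> f - g = c%:P -> coprimep f g.
Proof.
move=> c0 E; apply/Bezout_coprimepP; exists (1, -1).
by rewrite /= mul1r mulN1r E polyC_eqp1.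
Qed.

(* S1 and S2 collect the roots at which f takes the values 1 and -1: f - 1 and
   f + 1 are coprime with product D g^2, D the product of the X - z. *)
Lemma pell_factor (R : rcfType) (rs : seq R) (f g : {poly R}) :
  uniq rs -> (1 < size f)%N ->
  f ^+ 2 - (\prod_(z <- rs) ('X - z%:P)) * g ^+ 2 = 1 ->
  exists p q S1 S2 : {poly R},
    [/\ S1 \is monic, S2 \is monic, S1 * S2 = \prod_(z <- rs) ('X - z%:P),
        S1 * p ^+ 2 - S2 * q ^+ 2 = 1 \/ S1 * p ^+ 2 - S2 * q ^+ 2 = -1 &
        size (S1 * p ^+ 2) = size f /\ size (S2 * q ^+ 2) = size f].
Proof.
move=> urs sf E.
pose S1 := \prod_(z <- rs | f.[z] == 1) ('X - z%:P).
pose S2 := \prod_(z <- rs | f.[z] != 1) ('X - z%:P).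
have ES : S1 * S2 = \prod_(z <- rs) ('X - z%:P).
  by rewrite [RHS](bigID (fun z => f.[z] == 1)).
have m1 : S1 \is monic by apply: monic_prod => i _; exact: monicXsubC.
have m2 : S2 \is monic by apply: monic_prod => i _; exact: monicXsubC.
have dS1 : S1 %| f - 1.
  rewrite /S1 -big_filter; apply: uniq_roots_dvdp; last first.
    by rewrite uniq_rootsE filter_uniq.
  apply/allP => z; rewrite mem_filter => /andP[/eqP fz _].
  by rewrite rootE !hornerE fz subrr.
have dS2 : S2 %| f + 1.
  rewrite /S2 -big_filter; apply: uniq_roots_dvdp; last first.
    by rewrite uniq_rootsE filter_uniq.
  apply/allP => z; rewrite mem_filter => /andP[fz zrs].
  have := congr1 (horner^~ z) E; rewrite /= !hornerE.
  rewrite horner_prod (bigD1_seq z) //= !hornerE subrr !mul0r subr0 => /eqP.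
  by rewrite rootE !hornerE sqrf_eq1 (negbTE fz) /= => /eqP ->; rewrite addNr.
have [u Eu] := dvdpP _ _ dS1; have [v Ev] := dvdpP _ _ dS2.
have lf c : lead_coef (f + c%:P) = lead_coef f.
  by rewrite lead_coefDl // (leq_ltn_trans (size_polyC_leq1 _)).
have l1 : lead_coef (f - 1) = lead_coef f by rewrite -(lf (-1)) polyCN.
have l2 : lead_coef (f + 1) = lead_coef f by exact: (lf 1).
have lf0 : lead_coef f != 0 by rewrite lead_coef_eq0 -size_poly_gt0; lia.
have u0 : u != 0.
  by apply: contraNneq lf0 => u0; rewrite -l1 Eu u0 mul0r lead_coef0.
have v0 : v != 0.
  by apply: contraNneq lf0 => v0; rewrite -l2 Ev v0 mul0r lead_coef0.
have two0 : 2 != 0 :> R by rewrite pnatr_eq0.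
have cuv : coprimep u v.
  apply: (@coprimep_dvdr _ (u * S1)); first exact: dvdp_mulr.
  apply: (@coprimep_dvdl _ (v * S2)); first exact: dvdp_mulr.
  rewrite coprimep_sym; apply: (@coprimep_subC _ _ _ 2) => //.
  by rewrite -Eu -Ev polyC_natr; ring.
have Euv : u * v = g ^+ 2.
  apply: (mulfI (monic_neq0 m1)); apply: (mulfI (monic_neq0 m2)).
  have -> : S2 * (S1 * (u * v)) = (u * S1) * (v * S2) by ring.
  have -> : S2 * (S1 * g ^+ 2) = f ^+ 2 - (f ^+ 2 - S1 * S2 * g ^+ 2) by ring.
  by rewrite -Eu -Ev ES E; ring.
have [c c0 [p0 Ep]] := coprime_mul_square u0 cuv Euv.
have [d d0 [q0 Eq]] : exists2 d, d != 0 & exists g : {poly R}, v = d *: g ^+ 2.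
  by apply: (@coprime_mul_square _ v u g) => //; rewrite ?(mulrC v) // coprimep_sym.
have lc : lead_coef f = c * lead_coef p0 ^+ 2.
  by rewrite -l1 Eu lead_coef_Mmonic // Ep lead_coefZ lead_coef_exp.
have ld : lead_coef f = d * lead_coef q0 ^+ 2.
  by rewrite -l2 Ev lead_coef_Mmonic // Eq lead_coefZ lead_coef_exp.
(* Both c and d have the sign e of the leading coefficient of f, so e c and e d have real square
   roots. The common factor e / 2 makes the final difference equal to -e. *)
pose e := Num.sg (lead_coef f).
have e2 : e = 1 \/ e = -1.
  rewrite /e; move: lf0; rewrite neq_lt => /orP[l|l].
    by right; rewrite ltr0_sg.
  by left; rewrite gtr0_sg.
have sgE x y : lead_coef f = x * y ^+ 2 -> e * x = `|x|.
  move=> Ex; rewrite mulrC normrEsg mulrC /e Ex sgrM sgrX sqr_sg.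
  have -> : y != 0 by apply: contraNneq lf0 => y0; rewrite Ex y0 expr0n mulr0.
  by rewrite mulr1.
have root x (h : {poly R}) : e * x = `|x| ->
    (Num.sqrt (`|x| / 2) *: h) ^+ 2 = (e / 2) *: (x *: h ^+ 2).
  move=> Ex; rewrite exprZn sqr_sqrtr ?divr_ge0 //.
  by rewrite scalerA -Ex mulrAC.
have A1 : S1 * (Num.sqrt (`|c| / 2) *: p0) ^+ 2 = (e / 2)%:P * (f - 1).
  by rewrite (root _ _ (sgE _ _ lc)) -Ep Eu mulrC -scalerAl mul_polyC.
have A2 : S2 * (Num.sqrt (`|d| / 2) *: q0) ^+ 2 = (e / 2)%:P * (f + 1).
  by rewrite (root _ _ (sgE _ _ ld)) -Eq Ev mulrC -scalerAl mul_polyC.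
have half : (e / 2)%:P * 2 = e%:P :> {poly R}.
  by rewrite -polyC_natr -polyCM divfK.
exists (Num.sqrt (`|c| / 2) *: p0), (Num.sqrt (`|d| / 2) *: q0), S1, S2.
split=> //; rewrite A1 A2.
  have -> : (e / 2)%:P * (f - 1) - (e / 2)%:P * (f + 1) = - ((e / 2)%:P * 2).
    by ring.
  by rewrite half; case: e2 => ->; [right|left]; rewrite ?polyCN ?opprK.
have e0 : e / 2 != 0 by rewrite mulf_neq0 ?invr_eq0 // sgr_eq0.
rewrite !mul_polyC !size_scale // -[- 1]polyCN.
by split; rewrite size_polyDl // (leq_ltn_trans (size_polyC_leq1 _)).
Qed.

(** * Degrees, uniqueness and existence of splittings *)

Lemma size_Msqr_monic (R : idomainType) (S p : {poly R}) (d e : nat) :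
  S \is monic -> size S = d.+1 -> size p = e.+1 ->
  size (S * p ^+ 2) = (d + e.*2).+1.
Proof.
move=> mS sS sp; have p0 : p != 0 by rewrite -size_poly_eq0 sp.
rewrite size_monicM ?sqrf_eq0 // sS expr2 size_mul // sp; lia.
Qed.

Lemma lead_coef_Msqr_gt0 (R : realDomainType) (S p : {poly R}) :
  S \is monic -> p != 0 -> 0 < lead_coef (S * p ^+ 2).
Proof.
move=> /monicP mS p0; rewrite lead_coefM mS mul1r lead_coef_exp.
by rewrite lt0r sqrf_eq0 lead_coef_eq0 p0 sqr_ge0.
Qed.

(** In both degree cases the two summands have degree 2n and positive leading coefficient, so their
    sum keeps both properties. The Pell equation is (A + B)^2 - 4AB = (A - B)^2. *)
Lemma pell_splittingP (R : realType) (a b l0 : R) (n : nat) (p q S1 S2 : {poly R}) :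
  (1 <= n)%N -> pell_splitting a b l0 n p q S1 S2 ->
  [/\ size (S1 * p ^+ 2 + S2 * q ^+ 2) = (2 * n).+1,
      0 < lead_coef (S1 * p ^+ 2 + S2 * q ^+ 2),
      size (2 * (p * q)) = (2 * n - 2).+1 &
      pell_equation a b l0 (S1 * p ^+ 2 + S2 * q ^+ 2) (2 * (p * q))].
Proof.
move=> n1 [deg m1 m2 ES E].
have [p0 q0] : p != 0 /\ q != 0.
  by rewrite -!size_poly_eq0; case: deg => [[-> -> _ _]|[_ -> -> _ _]].
have sA : size (S1 * p ^+ 2) = (2 * n).+1.
  case: deg => [[sp _ sS _]|[n2 sp _ sS _]]; rewrite (size_Msqr_monic m1 sS sp); lia.
have sB : size (S2 * q ^+ 2) = (2 * n).+1.
  case: deg => [[_ sq _ sS]|[n2 _ sq _ sS]]; rewrite (size_Msqr_monic m2 sS sq); lia.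
have [] := @lead_coefD_gt0 _ (S1 * p ^+ 2) (S2 * q ^+ 2).
- by rewrite sA sB.
- exact: lead_coef_Msqr_gt0.
- exact: lead_coef_Msqr_gt0.
rewrite sA => sAB lAB; split=> //.
  rewrite -polyC_natr mul_polyC size_scale ?pnatr_eq0 // size_mul //.
  case: deg => [[-> -> _ _]|[n2 -> -> _ _]]; lia.
rewrite /pell_equation -ES.
have -> : (S1 * p ^+ 2 + S2 * q ^+ 2) ^+ 2 - S1 * S2 * (2 * (p * q)) ^+ 2 =
          (S1 * p ^+ 2 - S2 * q ^+ 2) ^+ 2 by ring.
by case: E => ->; rewrite ?sqrrN expr1n.
Qed.

Lemma pell_splitting_norm (R : realType) (a b l0 : R) (n : nat)
    (p q S1 S2 f g : {poly R}) :
  (1 <= n)%N -> pell_splitting a b l0 n p q S1 S2 ->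
  has_degree f (2 * n) -> has_degree g (2 * n - 2) -> pell_equation a b l0 f g ->
  S1 * p ^+ 2 + S2 * q ^+ 2 = f \/ S1 * p ^+ 2 + S2 * q ^+ 2 = - f.
Proof.
move=> n1 /(pell_splittingP n1)[_ _ sg E'] sf sg0 E.
apply: (pell_unique _ sg0 sg _ E E'); first by rewrite pnatr_eq0.
rewrite sf; lia.
Qed.

(** Positive leading coefficients fix the sign left open by [pell_unique], so the sums S1 p^2 + S2
    q^2 agree. The differences agree up to sign, hence the terms agree up to order; they are coprime
    because their difference is a nonzero constant. *)
Lemma pell_splitting_unique (R : realType) (a b l0 : R) (n : nat)
    (p q S1 S2 p' q' T1 T2 : {poly R}) :
  (1 <= n)%N -> pell_splitting a b l0 n p q S1 S2 ->
  pell_splitting a b l0 n p' q' T1 T2 ->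
  same_splitting p q S1 S2 p' q' T1 T2.
Proof.
move=> n1 sp sp'.
have [s l sg E] := pell_splittingP n1 sp.
have [_ l' _ _] := pell_splittingP n1 sp'.
have ED : T1 * p' ^+ 2 + T2 * q' ^+ 2 = S1 * p ^+ 2 + S2 * q ^+ 2.
  have [//|EN] := pell_splitting_norm n1 sp' s sg E.
  by move: l'; rewrite EN lead_coefN oppr_gt0 ltNge ltW.
case: sp sp' => [_ m1 m2 ES EB] [_ m1' m2' ES' EB'].
have two0 : 2 != 0 :> {poly R} by rewrite -polyC_natr polyC_eq0 pnatr_eq0.
have cop : coprimep (S1 * p ^+ 2) (S2 * q ^+ 2).
  by case: EB => EB; [apply: (@coprimep_subC _ _ _ 1)|apply: (@coprimep_subC _ _ _ (-1))];
    rewrite ?oppr_eq0 ?oner_eq0 // EB ?polyCN.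
have half (x y z t : {poly R}) : x + y = z + t -> x - y = z - t -> x = z /\ y = t.
  move=> e1 e2; suff xz : x = z by split=> //; move: e1; rewrite xz => /addrI.
  apply: (mulfI two0).
  have -> : 2 * x = (x + y) + (x - y) by ring.
  by rewrite e1 e2; ring.
have [D|D] : T1 * p' ^+ 2 - T2 * q' ^+ 2 = S1 * p ^+ 2 - S2 * q ^+ 2 \/
    T1 * p' ^+ 2 - T2 * q' ^+ 2 = S2 * q ^+ 2 - S1 * p ^+ 2.
  rewrite -[S2 * q ^+ 2 - _]opprB.
  by case: EB EB' => -> [] ->; rewrite ?opprK; auto.
- have [A B] := half _ _ _ _ ED D; left.
  by apply: (coprime_monic_square_eq m1 m1' (monic_neq0 m2)) => //; rewrite ES ES'.
- have [A B] := half _ _ _ _ (etrans ED (addrC _ _)) D; right.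
  have [-> -> ? ?] : [/\ T2 = S1, T1 = S2, q' = p \/ q' = - p & p' = q \/ p' = - q].
    apply: (coprime_monic_square_eq m1 m2' (monic_neq0 m2)) => //.
    by rewrite ES mulrC ES'.
  by split.
Qed.

Lemma pell_quarticE (R : realType) (a b l0 : R) :
  pell_quartic a b l0 = \prod_(z <- [:: 0; a^-1; b^-1; l0^-1]) ('X - z%:P).
Proof. by rewrite /pell_quartic !big_cons big_nil; ring. Qed.

Lemma uniq_pell_roots (R : realType) (a b l0 : R) :
  0 < b -> b < a -> 0 < l0 < b \/ b < l0 < a ->
  uniq [:: 0; a^-1; b^-1; l0^-1].
Proof.
move=> b0 ba hl; rewrite /= !inE !negb_or !(inj_eq invr_inj) !(eq_sym 0) !invr_eq0.
by rewrite andbT; do !(apply/andP; split); apply/eqP => E; move: b0 ba hl; rewrite ?E; lra.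
Qed.

(** From deg S1 + 2 deg p = 2n, deg S1 is even, hence 0, 2 or 4; exchanging the factors turns 4 into
    0. *)
Lemma pell_splitting_exists (R : realType) (a b l0 : R) (n : nat) (f g : {poly R}) :
  uniq [:: 0; a^-1; b^-1; l0^-1] -> (1 <= n)%N ->
  has_degree f (2 * n) -> has_degree g (2 * n - 2) -> pell_equation a b l0 f g ->
  exists p q S1 S2 : {poly R}, pell_splitting a b l0 n p q S1 S2.
Proof.
move=> urs n1 sf sg; rewrite /pell_equation pell_quarticE => E.
have sf1 : (1 < size f)%N by rewrite (sf : size f = _); lia.
have [p [q [S1 [S2 [m1 m2 ES EB []]]]]] := pell_factor urs sf1 E.
rewrite (sf : size f = _) => sA sB.
have nz (S r : {poly R}) : size (S * r ^+ 2) = (2 * n).+1 -> r != 0.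
  by move=> s; apply/eqP => r0; move: s; rewrite r0 expr0n mulr0 size_poly0.
have sz (S r : {poly R}) : S \is monic -> size (S * r ^+ 2) = (2 * n).+1 ->
    exists d e, [/\ size S = d.+1, size r = e.+1 & (d + e.*2 = 2 * n)%N].
  move=> mS s; exists (size S).-1, (size r).-1.
  have sS : (size S).-1.+1 = size S by rewrite prednK // size_poly_gt0 monic_neq0.
  have sr : (size r).-1.+1 = size r by rewrite prednK // size_poly_gt0 (nz S).
  by split=> //; move: s; rewrite (size_Msqr_monic mS (esym sS) (esym sr)) => -[].
have [d1 [e1 [sS1 sp E1]]] := sz _ _ m1 sA.
have [d2 [e2 [sS2 sq E2]]] := sz _ _ m2 sB.
have E12 : (d1 + d2 = 4)%N.
  have : size (S1 * S2) = 5%N by rewrite ES size_prod_XsubC.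
  by rewrite size_monicM ?monic_neq0 // sS1 sS2 /=; lia.
have even_half d e : (d + e.*2 = 2 * n)%N -> ~~ odd d by lia.
have od1 := even_half _ _ E1.
have [D|[D|D]] : d1 = 0%N \/ d1 = 2%N \/ d1 = 4%N by lia.
- exists p, q, S1, S2; split; rewrite ?pell_quarticE //; right.
  by rewrite /has_degree sp sq sS1 sS2; split; try congr _.+1; lia.
- exists p, q, S1, S2; split; rewrite ?pell_quarticE //; left.
  by rewrite /has_degree sp sq sS1 sS2; split; try congr _.+1; lia.
- exists q, p, S2, S1; split=> //.
  + by right; rewrite /has_degree sp sq sS1 sS2; split; try congr _.+1; lia.
  + by rewrite mulrC pell_quarticE.
  + by rewrite -[S2 * q ^+ 2 - _]opprB; case: EB => ->; rewrite ?opprK; auto.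
Qed.

(** On the roots of S1 and of S2, f takes opposite values. Equal values at 0, 1/a, 1/b put three
    distinct roots in one factor; S1 has degree at most 2, so that factor is S2, of degree 4. *)
Lemma pell_splitting_trivial (R : realType) (a b l0 : R) (n : nat)
    (p q S1 S2 f g : {poly R}) :
  uniq [:: 0; a^-1; b^-1; l0^-1] -> (1 <= n)%N -> pell_splitting a b l0 n p q S1 S2 ->
  has_degree f (2 * n) -> has_degree g (2 * n - 2) -> pell_equation a b l0 f g ->
  (S1 = 1) <-> (f.[a^-1] = f.[0] /\ f.[b^-1] = f.[0]).
Proof.
move=> urs n1 sp sf sg E.
have EN := pell_splitting_norm n1 sp sf sg E.
case: sp => [deg m1 m2 ES EB]; rewrite pell_quarticE in ES.
have hS z : z \in [:: 0; a^-1; b^-1; l0^-1] -> S1.[z] * S2.[z] = 0.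
  by move=> zr; rewrite -hornerM ES horner_prod (bigD1_seq z) //= !hornerE subrr mul0r.
have [eta eta0 Ef] : exists2 eta : R, eta != 0 &
    forall z, f.[z] = eta * (S1.[z] * p.[z] ^+ 2 + S2.[z] * q.[z] ^+ 2).
  case: EN => EN; [exists 1|exists (-1)]; rewrite ?oppr_eq0 ?oner_eq0 // => z;
    by move/(congr1 (horner^~ z)): EN; rewrite !hornerE => ->; ring.
have [eps eps0 De] : exists2 eps : R, eps != 0 &
    forall z, S1.[z] * p.[z] ^+ 2 - S2.[z] * q.[z] ^+ 2 = eps.
  case: EB => EB; [exists 1|exists (-1)]; rewrite ?oppr_eq0 ?oner_eq0 // => z;
    by move/(congr1 (horner^~ z)): EB; rewrite !hornerE.
have fS1 z : S1.[z] = 0 -> f.[z] = - (eta * eps).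
  by move=> S0; rewrite Ef -(De z) S0; ring.
have fS2 z : S2.[z] = 0 -> f.[z] = eta * eps.
  by move=> S0; rewrite Ef -(De z) S0; ring.
have h0 : 0 \in [:: 0; a^-1; b^-1; l0^-1] by rewrite !inE eqxx.
have ha : a^-1 \in [:: 0; a^-1; b^-1; l0^-1] by rewrite !inE eqxx orbT.
have hb : b^-1 \in [:: 0; a^-1; b^-1; l0^-1] by rewrite !inE eqxx !orbT.
split=> [S11|[Ea Eb]].
  have S2z z : z \in [:: 0; a^-1; b^-1; l0^-1] -> S2.[z] = 0.
    by move=> /hS; rewrite S11 hornerE mul1r.
  by rewrite !fS2 // S2z.
have u3 : uniq [:: 0; a^-1; b^-1] by move: (take_uniq 3 urs).
have ee0 : eta * eps != 0 by rewrite mulf_neq0.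
have [S10|S10] := eqVneq S1.[0] 0.
  have S1z z : z \in [:: 0; a^-1; b^-1; l0^-1] -> f.[z] = f.[0] -> S1.[z] = 0.
    move=> zr; rewrite (fS1 _ S10) => fz; apply/eqP; move/eqP: (hS _ zr).
    rewrite mulf_eq0 => /orP[//|/eqP/fS2]; rewrite fz => e; move/eqP: ee0; lra.
  have r3 : all (root S1) [:: 0; a^-1; b^-1].
    by rewrite /= !rootE S10 !S1z ?eqxx.
  have := max_poly_roots (monic_neq0 m1) r3 u3.
  by case: deg => [[_ _ -> _]|[_ _ _ -> _]].
have S20 : S2.[0] = 0.
  by apply/eqP; move/eqP: (hS _ h0); rewrite mulf_eq0 (negbTE S10).
have S2z z : z \in [:: 0; a^-1; b^-1; l0^-1] -> f.[z] = f.[0] -> S2.[z] = 0.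
  move=> zr; rewrite (fS2 _ S20) => fz; apply/eqP; move/eqP: (hS _ zr).
  rewrite mulf_eq0 => /orP[/eqP/fS1|//]; rewrite fz => e; move/eqP: ee0; lra.
have r3 : all (root S2) [:: 0; a^-1; b^-1].
  by rewrite /= !rootE S20 !S2z ?eqxx.
have := max_poly_roots (monic_neq0 m2) r3 u3.
case: deg => [[_ _ _ ->]//|[_ _ _ /eqP/size_poly1P[c _ S1c] _] _].
by move: m1; rewrite S1c monicE lead_coefC => /eqP ->.
Qed.

(** * Degree descent *)

Lemma coefM_top (R : nzRingType) (p q : {poly R}) (i j k : nat) :
  (size p <= i.+1)%N -> (size q <= j.+1)%N -> (i + j = k)%N ->
  (p * q)`_k = p`_i * q`_j.
Proof.
move=> sp sq <-; have ik : (i < (i + j).+1)%N by lia.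
rewrite coefM (bigD1 (Ordinal ik)) //= addKn big1 ?addr0 // => l li.
have {}li : nat_of_ord l <> i by move=> E; case/eqP: li; apply: val_inj.
have [lt|le] := ltnP i l.
  by rewrite [p`_l]nth_default ?mul0r // (leq_trans sp).
by rewrite [q`__]nth_default ?mulr0 // (leq_trans sq) //; lia.
Qed.

Lemma size_coef_eq0 (R : nzRingType) (p : {poly R}) (n : nat) :
  (size p <= n.+1)%N -> p`_n = 0 -> (size p <= n)%N.
Proof.
move=> sp p0; apply/leq_sizeP => j; rewrite leq_eqVlt => /orP[/eqP <- //|nj].
by apply: nth_default; apply: leq_trans nj.
Qed.

(* For L = [[v, u], [w, -v]], L0 = [[v0, u0], [w0, -v0]] and
   E = [[e11, e12], [e21, e22]]: det E = 1 and the second row of E L = L0 E. *)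
Definition intertwines (R : nzRingType) (v0 w0 v u w e11 e12 e21 e22 : {poly R}) :=
  [/\ e11 * e22 - e12 * e21 = 1,
      e21 * v + e22 * w = w0 * e11 - v0 * e21 &
      e21 * u - e22 * v = w0 * e12 - v0 * e22].

(* L becomes S L S^-1 and E becomes E S^-1, where
   S = [[1, 0], [-mu, 1]] [[1, t], [0, 1]]. *)
Lemma intertwines_step (R : comNzRingType)
    (v0 w0 v u w e11 e12 e21 e22 t mu : {poly R}) :
  intertwines v0 w0 v u w e11 e12 e21 e22 ->
  let u' := u - 2 * t * v - t ^+ 2 * w in
  let v' := v + t * w + mu * u' in
  let w' := w - 2 * mu * (v + t * w) - mu ^+ 2 * u' in
  let h1 := e12 - t * e11 in
  let h2 := e22 - t * e21 in
  intertwines v0 w0 v' u' w' (e11 + mu * h1) h1 (e21 + mu * h2) h2.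
Proof.
move=> [E1 E2 E3] /=.
split.
- by rewrite -[RHS]E1; ring.
- set X := LHS; have -> : X = (e21 * v + e22 * w) * (1 - t * mu) +
     mu * (e21 * u - e22 * v) by rewrite /X; ring.
  by rewrite E2 E3; ring.
- set X := LHS; have -> : X = (e21 * u - e22 * v) - t * (e21 * v + e22 * w).
    by rewrite /X; ring.
  by rewrite E2 E3; ring.
Qed.

(* The leading coefficients of the second row are proportional to (1, t)
   because they form a left eigenvector of the leading coefficient of L; those
   of the first row then are so because det E = 1. *)
Lemma intertwines_descent (F : fieldType)
    (v0 w0 v u w e11 e12 e21 e22 v' u' w' : {poly F}) (c t mu : F) (m : nat) :
  2 != 0 :> F -> c != 0 -> t * w`_2 = - (2 * c) ->
  (size v0 <= 3)%N -> v0`_2 = c -> (size w0 <= 3)%N ->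
  (size v <= 3)%N -> v`_2 = c -> (size w <= 3)%N ->
  (size v' <= 3)%N -> v'`_2 = c -> (size w' <= 3)%N ->
  let h1 := e12 - t%:P * e11 in
  let h2 := e22 - t%:P * e21 in
  let g1 := e11 + mu%:P * 'X * h1 in
  let g2 := e21 + mu%:P * 'X * h2 in
  intertwines v0 w0 v u w e11 e12 e21 e22 ->
  intertwines v0 w0 v' u' w' g1 h1 g2 h2 ->
  (size e11 <= m.+1)%N -> (size e12 <= m.+1)%N ->
  (size e21 <= m.+2)%N -> (size e22 <= m.+2)%N -> e22`_m.+1 != 0 ->
  [/\ (size g1 <= m.+1)%N, (size h1 <= m)%N, (size g2 <= m.+1)%N,
      (size h2 <= m.+1)%N & h2`_m != 0 /\ ((0 < m)%N -> (size g1 <= m)%N)].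
Proof.
move=> c2 c0 tw sv0 v0c sw0 sv vc sw sv' vc' sw' h1 h2 g1 g2
  [D E1 _] [D' E1' _] s11 s12 s21 s22 top.
have w20 : w`_2 != 0.
  by apply: contraNneq (mulf_neq0 c2 c0) => w0'; rewrite -oppr_eq0 -tw w0' mulr0.
(* Coefficient of s^(m+3) in the second-row equation; [w0 * e11] has degree at most m + 2. *)
have top21 : e22`_m.+1 = t * e21`_m.+1.
  have := congr1 (fun p : {poly F} => p`_(m.+1 + 2)) E1.
  rewrite /= coefD coefB (coefM_top s21 sv) // (coefM_top s22 sw) //.
  rewrite (coefM_top sw0 (leq_trans s11 (leqnSn _))) 1?addnC //.
  rewrite [e11`_m.+1]nth_default // mulr0 (coefM_top sv0 s21) 1?addnC // v0c vc => H.
  apply: (mulIf w20); rewrite mulrAC tw.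
  have -> : e22`_m.+1 * w`_2 =
      (e21`_m.+1 * c + e22`_m.+1 * w`_2) - c * e21`_m.+1 by ring.
  by rewrite H; ring.
have e21t : e21`_m.+1 != 0 by apply: contraNneq top => H; rewrite top21 H mulr0.
have sh2 : (size h2 <= m.+1)%N.
  apply: size_coef_eq0; last by rewrite coefB coefCM top21 subrr.
  by rewrite (leq_trans (size_polyD _ _)) // size_polyN geq_max s22 mul_polyC
             (leq_trans (size_scale_leq _ _)).
(* Coefficient of s^(2m+1) in det E = 1, which is 0. *)
have top12 : e12`_m = t * e11`_m.
  have := congr1 (fun p : {poly F} => p`_(m + m.+1)) D.
  rewrite /= coefB (coefM_top s11 s22) // (coefM_top s12 s21) // top21 coef1 addnS /=.
  move=> /eqP; rewrite subr_eq0 mulrA => /eqP /(mulIf e21t) <-; exact: mulrC.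
have szC (x : F) (p q : {poly F}) k : (size p <= k)%N -> (size q <= k)%N ->
    (size (p - x%:P * q)%R <= k)%N.
  move=> sp sq; rewrite (leq_trans (size_polyD _ _)) // size_polyN geq_max sp.
  by rewrite mul_polyC (leq_trans (size_scale_leq _ _)).
have szX (p q : {poly F}) k : (size p <= k.+1)%N -> (size q <= k)%N ->
    (size (p + mu%:P * 'X * q)%R <= k.+1)%N.
  move=> sp sq; rewrite (leq_trans (size_polyD _ _)) // geq_max sp -mulrA.
  rewrite mul_polyC (leq_trans (size_scale_leq _ _)) // mulrC.
  by rewrite (leq_trans (size_polyMleq _ _)) // size_polyX addn2.
have sh1 : (size h1 <= m)%N.
  by apply: size_coef_eq0; [exact: szC|rewrite coefB coefCM top12 subrr].
have sg1 : (size g1 <= m.+1)%N by exact: szX.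
have sg2' : (size g2 <= m.+2)%N by exact: szX.
(* The same second-row coefficient after the step: [g1] and [h2] now have degree at most m, which
   leaves 2 c times the top of [g2]. *)
have g2m : g2`_m.+1 = 0.
  have := congr1 (fun p : {poly F} => p`_(m.+1 + 2)) E1'.
  rewrite /= coefD coefB (coefM_top sg2' sv') // (coefM_top (leq_trans sh2 (leqnSn _)) sw') //.
  rewrite (coefM_top sw0 (leq_trans sg1 (leqnSn _))) 1?addnC //.
  rewrite [g1`_m.+1]nth_default // [h2`_m.+1]nth_default // mul0r mulr0.
  rewrite (coefM_top sv0 sg2') 1?addnC // v0c vc' addr0 sub0r => H.
  have : 2 * c * g2`_m.+1 = 0.
    have -> : 2 * c * g2`_m.+1 = g2`_m.+1 * c + c * g2`_m.+1 by ring.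
    by rewrite H addNr.
  by move/eqP; rewrite mulf_eq0 (negbTE (mulf_neq0 c2 c0)) => /eqP.
have sg2 : (size g2 <= m.+1)%N by exact: size_coef_eq0.
have h2m : h2`_m != 0.
  apply: contraNneq e21t => h20; move: g2m.
  by rewrite coefD -mulrA coefCM coefXM /= h20 mulr0 addr0 => ->.
(* The coefficient of s^(2m) in the new determinant is 0 for m > 0, but 1 for m = 0, where [g1]
   stays a nonzero constant. *)
split=> //; split=> // m0; apply: size_coef_eq0 => //.
have := congr1 (fun p : {poly F} => p`_(m + m)) D'.
rewrite /= coefB (coefM_top sg1 sh2) // (coefM_top (leq_trans sh1 (leqnSn _)) sg2) //.
rewrite [h1`_m]nth_default // mul0r subr0 coef1.
by case: (m) m0 h2m => // m' _ h2m /= /eqP; rewrite mulf_eq0 (negbTE h2m) orbF => /eqP.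
Qed.

(** * The Lax matrix of a billiard segment *)

Lemma on_ellipseE (R : realType) (a b : R) (P : R * R) :
  a != 0 -> b != 0 -> on_ellipse a b P <-> b * P.1 ^+ 2 + a * P.2 ^+ 2 = a * b.
Proof.
move=> a0 b0; rewrite /on_ellipse.
have -> : P.1 ^+ 2 / a + P.2 ^+ 2 / b = (b * P.1 ^+ 2 + a * P.2 ^+ 2) / (a * b).
  by field; rewrite a0 b0.
split=> [/(canRL (mulfVK (mulf_neq0 a0 b0)))->|->]; first exact: mul1r.
by rewrite divff ?mulf_neq0.
Qed.

(* This is a b <n, w> for n = (x / a, y / b) the normal at P = (x, y). *)
Definition joachimsthal (R : realType) (a b : R) (P w : R * R) : R :=
  b * P.1 * w.1 + a * P.2 * w.2.

(** With xi = x / (a - l) and eta = y / (b - l), tangency reads (a - l) xi^2 + (b - l) eta^2 = z^2.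
    As (xi, eta) is orthogonal to w = B - A, it is a nonzero multiple k of (-w2, w1); k^2 cancels,
    and Lagrange's identity with A on the ellipse finishes. *)
Lemma tangent_joachimsthal (R : realType) (a b l : R) (A B : R * R) :
  a != 0 -> b != 0 -> l != a -> l != b -> B <> A -> on_ellipse a b A ->
  tangent_to_confocal a b l A B ->
  a * b * l * dot (B - A) (B - A) = joachimsthal a b A (B - A) ^+ 2.
Proof.
move=> a0 b0 la lb BA /(on_ellipseE _ a0 b0) HA [x [y [z [nz Hz HzA HzB]]]].
have al : a - l != 0 by rewrite subr_eq0 eq_sym.
have bl : b - l != 0 by rewrite subr_eq0 eq_sym.
case: A B => [A1 A2] [B1 B2] /= in BA HA HzA HzB *.
rewrite /joachimsthal /dot /=.
set w1 := B1 - A1; set w2 := B2 - A2.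
pose xi := x / (a - l); pose eta := y / (b - l).
have Ex : x = xi * (a - l) by rewrite /xi divfK.
have Ey : y = eta * (b - l) by rewrite /eta divfK.
have w0 : w1 ^+ 2 + w2 ^+ 2 != 0.
  rewrite paddr_eq0 ?sqr_ge0 // !sqrf_eq0; apply/negP => /andP[/eqP e1 /eqP e2].
  by apply: BA; congr pair; apply/eqP; rewrite -subr_eq0 -/w1 -/w2 ?e1 ?e2.
have {}HzA : A1 * xi + A2 * eta = z by rewrite -HzA /xi /eta !mulrA.
have orth : w1 * xi + w2 * eta = 0.
  have : B1 * xi + B2 * eta = z by rewrite -HzB /xi /eta !mulrA.
  by rewrite -HzA /w1 /w2 => E; rewrite !mulrBl; lra.
have {}Hz : (a - l) * xi ^+ 2 + (b - l) * eta ^+ 2 = z ^+ 2.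
  by rewrite -Hz /xi /eta; field; rewrite al bl.
pose k := (eta * w1 - xi * w2) / (w1 ^+ 2 + w2 ^+ 2).
have kE : k * (w1 ^+ 2 + w2 ^+ 2) = eta * w1 - xi * w2 by rewrite /k divfK.
have Exi : xi = - k * w2.
  apply: (mulIf w0).
  have -> : - k * w2 * (w1 ^+ 2 + w2 ^+ 2) = - (k * (w1 ^+ 2 + w2 ^+ 2)) * w2 by ring.
  rewrite kE -[LHS](subrK (w1 * (w1 * xi + w2 * eta))) {2}orth mulr0; ring.
have Eeta : eta = k * w1.
  apply: (mulIf w0).
  have -> : k * w1 * (w1 ^+ 2 + w2 ^+ 2) = k * (w1 ^+ 2 + w2 ^+ 2) * w1 by ring.
  rewrite kE -[LHS](subrK (w2 * (w1 * xi + w2 * eta))) {2}orth mulr0; ring.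
have k0 : k != 0.
  apply/eqP => k0; apply: nz; rewrite -HzA Ex Ey Exi Eeta k0.
  by split; ring.
have key : (a - l) * w2 ^+ 2 + (b - l) * w1 ^+ 2 = (A2 * w1 - A1 * w2) ^+ 2.
  apply: (mulfI (expf_neq0 2 k0)).
  move: Hz; rewrite -HzA Exi Eeta => Hz.
  by transitivity ((a - l) * (- k * w2) ^+ 2 + (b - l) * (k * w1) ^+ 2);
    [ring|rewrite Hz; ring].
have -> : a * b * l * (w1 * w1 + w2 * w2) =
  a * b * (a * w2 ^+ 2 + b * w1 ^+ 2 - ((a - l) * w2 ^+ 2 + (b - l) * w1 ^+ 2)).
  by ring.
rewrite key.
transitivity ((b * A1 * w1 + a * A2 * w2) ^+ 2
   + (a * b - (b * A1 ^+ 2 + a * A2 ^+ 2)) * (a * w2 ^+ 2 + b * w1 ^+ 2)); first by ring.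
by rewrite HA subrr mul0r addr0.
Qed.

(* With l = 1 / s and <Y, Z>_l = Y.1 Z.1 / (a - l) + Y.2 Z.2 / (b - l), the
   polynomials lax_v, lax_u, lax_w in s are the products of
   (a s - 1) (b s - 1) with <P, w>_l, 1 - <P, P>_l and <w, w>_l.  In lax_u the
   coefficient of s^2 vanishes because P lies on the ellipse. *)
Definition lax_v (R : realType) (a b : R) (P w : R * R) : {poly R} :=
  (joachimsthal a b P w)%:P * 'X^2 - (dot P w)%:P * 'X.

Definition lax_u (R : realType) (a b : R) (P : R * R) : {poly R} :=
  1 - (a + b - dot P P)%:P * 'X.

Definition lax_w (R : realType) (a b : R) (w : R * R) : {poly R} :=
  (b * w.1 ^+ 2 + a * w.2 ^+ 2)%:P * 'X^2 - (dot w w)%:P * 'X.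

Lemma size_quadratic (R : nzRingType) (x y : R) :
  (size (x%:P * 'X^2 - y%:P * 'X)%R <= 3)%N.
Proof. by apply/leq_sizeP => -[|[|[|j]]] // _; rewrite !coefE !mulr0 subrr. Qed.

Lemma size_lax_u (R : realType) (a b : R) (P : R * R) : (size (lax_u a b P) <= 2)%N.
Proof. by apply/leq_sizeP => -[|[|j]] // _; rewrite !coefE mulr0 subrr. Qed.

Lemma coef2_quadratic (R : nzRingType) (x y : R) :
  (x%:P * 'X^2 - y%:P * 'X)`_2 = x.
Proof. by rewrite !coefE mulr1 mulr0 subr0. Qed.

(** With r = |w|^2, the hypothesis on [l] turns the right-hand side into r s (a s - 1)(b s - 1)(l s
    - 1). The coefficients of s^2 and s^3 ([E1], [E2]) match modulo the ellipse equation. *)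
Lemma lax_det (R : realType) (a b l : R) (P w : R * R) :
  a != 0 -> b != 0 -> l != 0 -> on_ellipse a b P ->
  a * b * l * dot w w = joachimsthal a b P w ^+ 2 ->
  lax_v a b P w ^+ 2 + lax_u a b P * lax_w a b w =
  (joachimsthal a b P w ^+ 2)%:P * pell_quartic a b l.
Proof.
move=> a0 b0 l0 /(on_ellipseE _ a0 b0); case: P w => [x y] [w1 w2] /= HP HJ.
rewrite /lax_v /lax_u /lax_w /pell_quartic.
set c := joachimsthal _ _ _ _ in HJ *; set r := dot (w1, w2) _ in HJ *.
set U := a + b - _; set q := b * _ + a * _; set p := dot _ _.
transitivity ((c ^+ 2)%:P * 'X^4 - (2 * c * p + U * q)%:P * 'X^3
  + (p ^+ 2 + q + U * r)%:P * 'X^2 - r%:P * 'X); first by ring.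
have E1 : p ^+ 2 + q + U * r = r * (l + a + b).
  apply: (mulfI (mulf_neq0 a0 b0)).
  have -> : a * b * (r * (l + a + b)) = a * b * l * r + a * b * r * (a + b) by ring.
  rewrite HJ.
  have -> : a * b * (p ^+ 2 + q + U * r) = c ^+ 2 + a * b * r * (a + b) + (a * b - (b * x ^+ 2 + a * y ^+ 2)) * (b * w1 ^+ 2 + a * w2 ^+ 2).
    rewrite /p /q /U /r /c /dot /joachimsthal /=; ring.
  by rewrite HP subrr mul0r addr0.
have E2 : 2 * c * p + U * q = r * (b * l + a * l + a * b).
  apply: (mulfI (mulf_neq0 a0 b0)).
  have -> : a * b * (r * (b * l + a * l + a * b)) =
    a * b * l * r * (a + b) + (a * b) ^+ 2 * r by ring.
  rewrite HJ.
  have -> : a * b * (2 * c * p + U * q) = c ^+ 2 * (a + b) + (a * b) ^+ 2 * r +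
      (a * b - (b * x ^+ 2 + a * y ^+ 2)) *
      ((a + b) * (b * w1 ^+ 2 + a * w2 ^+ 2) - a * b * r).
    by rewrite /p /q /U /r /c /dot /joachimsthal /=; ring.
  by rewrite HP subrr mul0r addr0.
rewrite E1 E2 -HJ.
have XsubV (k : R) : k != 0 -> k%:P * ('X - (k^-1)%:P) = k%:P * 'X - 1 :> {poly R}.
  by move=> k0; rewrite mulrBr -polyCM divff.
transitivity (r%:P * ('X * (a%:P * ('X - (a^-1)%:P)) * (b%:P * ('X - (b^-1)%:P))
   * (l%:P * ('X - (l^-1)%:P)))); last by ring.
by rewrite !XsubV //; ring.
Qed.

Lemma dot_gt0 (R : realType) (w : R * R) : w != 0 -> 0 < dot w w.
Proof.
case: w => w1 w2 w0; rewrite /dot /= lt0r addr_ge0 -?expr2 ?sqr_ge0 // andbT.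
rewrite paddr_eq0 ?sqr_ge0 // !sqrf_eq0; apply: contra w0 => /andP[/eqP -> /eqP ->].
exact/eqP.
Qed.

Lemma quadratic_form_gt0 (R : realType) (a b : R) (w : R * R) :
  0 < a -> 0 < b -> w != 0 -> 0 < b * w.1 ^+ 2 + a * w.2 ^+ 2.
Proof.
move=> a0 b0 w0; have ge0 (k z : R) : 0 < k -> 0 <= k * z ^+ 2.
  by move=> k0; exact: mulr_ge0 (ltW k0) (sqr_ge0 z).
rewrite lt0r addr_ge0 ?ge0 // andbT paddr_eq0 ?ge0 //.
rewrite (mulf_eq0 b) (mulf_eq0 a) (gt_eqF a0) (gt_eqF b0) /= !sqrf_eq0.
by apply: contra w0; case: w => w1 w2 /= /andP[/eqP -> /eqP ->]; apply/eqP.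
Qed.

(** Along the line through P the ellipse equation is quadratic in t with root 0; the relation
    describes its other root. *)
Lemma chord_joachimsthal (R : realType) (a b t : R) (P w : R * R) :
  0 < a -> 0 < b -> w != 0 -> t != 0 -> on_ellipse a b P ->
  on_ellipse a b (P + scale t w) ->
  t * (b * w.1 ^+ 2 + a * w.2 ^+ 2) = - (2 * joachimsthal a b P w) /\
  joachimsthal a b P w != 0.
Proof.
move=> a0 b0 w0 t0.
have an0 : a != 0 by rewrite gt_eqF.
have bn0 : b != 0 by rewrite gt_eqF.
rewrite !on_ellipseE //.
case: P w w0 => [x y] [w1 w2] w0 /= HP HP'.
have E : t * (b * w1 ^+ 2 + a * w2 ^+ 2) = - (2 * joachimsthal a b (x, y) (w1, w2)).
  apply: (mulfI t0); apply/eqP; rewrite -subr_eq0; apply/eqP.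
  transitivity ((b * (x + t * w1) ^+ 2 + a * (y + t * w2) ^+ 2) -
                (b * x ^+ 2 + a * y ^+ 2)); last by rewrite HP HP' subrr.
  by rewrite /joachimsthal /=; ring.
split=> //; apply: contraTneq (quadratic_form_gt0 a0 b0 w0) => c0.
suff -> : b * w1 ^+ 2 + a * w2 ^+ 2 = 0 by rewrite ltxx.
by apply: (mulfI t0); rewrite E c0 !mulr0 oppr0.
Qed.

(** Flight is the expansion of <P + t w, .>_l. For the reflection w' = w - mu n, the normal
    satisfies <n, Z>_l = s (<P', Z>_l - n . Z) with s = 1/l, and n . P' = 1; hence the lower
    triangular factor with entry linear in s. *)
Lemma billiard_step (R : realType) (a b t : R) (P w : R * R) :
  0 < a -> 0 < b -> w != 0 -> t != 0 -> on_ellipse a b P ->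
  let P' := P + scale t w in
  on_ellipse a b P' ->
  let n := ellipse_normal a b P' in
  let mu := 2 * dot w n / dot n n in
  let w' := reflect_vector n w in
  let u' := lax_u a b P - 2 * t%:P * lax_v a b P w - t%:P ^+ 2 * lax_w a b w in
  let M := mu%:P * 'X in
  [/\ joachimsthal a b P' w' = joachimsthal a b P w,
      dot w' w' = dot w w &
      [/\ lax_u a b P' = u',
      lax_v a b P' w' = lax_v a b P w + t%:P * lax_w a b w + M * u' &
      lax_w a b w' = lax_w a b w - 2 * M * (lax_v a b P w + t%:P * lax_w a b w)
                     - M ^+ 2 * u']].
Proof.
move=> a0 b0 w0 t0 HP P' HP' n mu w' u' M.
have [tq c0] := chord_joachimsthal a0 b0 w0 t0 HP HP'.
have an0 : a != 0 by rewrite gt_eqF.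
have bn0 : b != 0 by rewrite gt_eqF.
move: HP'; rewrite on_ellipseE // => HE.
case: P w w0 @P' @n @mu @w' @u' @M HP tq c0 HE => [x y] [w1 w2] w0.
set c := joachimsthal a b (x, y) _; set q := b * _ + a * _.
move=> P' n mu w' u' M HP tq c0 HE.
pose n1 := P'.1 / a; pose n2 := P'.2 / b.
have nE : n = (n1, n2) by [].
have P'E : P' = (a * n1, b * n2).
  by rewrite /n1 /n2 !(mulrC _ (_ / _)) !divfK // -surjective_pairing.
have H1 : a * n1 ^+ 2 + b * n2 ^+ 2 = 1.
  apply: (mulfI (mulf_neq0 an0 bn0)); rewrite mulr1 -[RHS]HE P'E /=; ring.
have N0 : n1 ^+ 2 + n2 ^+ 2 != 0.
  apply/negP; rewrite paddr_eq0 ?sqr_ge0 // => /andP[/eqP e1 /eqP e2].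
  by move: H1; rewrite e1 e2 !mulr0 addr0 => /eqP; rewrite eq_sym oner_eq0.
have muE : mu * (n1 ^+ 2 + n2 ^+ 2) = 2 * (w1 * n1 + w2 * n2).
  by rewrite /mu nE /dot /= -!expr2 divfK.
have xE : x = a * n1 - t * w1 by have := congr1 fst P'E => /= <-; rewrite addrK.
have yE : y = b * n2 - t * w2 by have := congr1 snd P'E => /= <-; rewrite addrK.
(* The direction w has Joachimsthal value c at P and -c at P'; the reflection restores c, as [cons]
   records. *)
have cE : a * b * (n1 * w1 + n2 * w2) = - c.
  have -> : - c = c + t * q by rewrite tq; ring.
  by rewrite /c /q /joachimsthal /= xE yE; ring.
have w'E : w' = (w1 - mu * n1, w2 - mu * n2) by [].
have UE : a + b - dot P' P' = a * b * (n1 ^+ 2 + n2 ^+ 2).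
  rewrite P'E; transitivity ((a + b) * (a * n1 ^+ 2 + b * n2 ^+ 2) -
    dot (a * n1, b * n2) (a * n1, b * n2)); first by rewrite H1 mulr1.
  by rewrite /dot /=; ring.
have mU : mu * (a + b - dot P' P') = - (2 * c).
  rewrite UE mulrCA muE -mulrN -cE; ring.
have norm : dot w' w' = dot (w1, w2) (w1, w2).
  rewrite w'E /dot /=.
  transitivity (w1 * w1 + w2 * w2 + mu *
     (mu * (n1 ^+ 2 + n2 ^+ 2) - 2 * (w1 * n1 + w2 * n2))); first by ring.
  by rewrite muE subrr mulr0 addr0.
have cons : joachimsthal a b P' w' = c.
  transitivity (a * b * (n1 * w1 + n2 * w2) - mu * (a + b - dot P' P')).
    by rewrite UE w'E P'E /joachimsthal /=; ring.
  by rewrite cE mU; ring.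
have dP' : dot P' w' = dot (x, y) (w1, w2) + t * dot (w1, w2) (w1, w2) - mu.
  transitivity (a * n1 * w1 + b * n2 * w2 - mu * (a * n1 ^+ 2 + b * n2 ^+ 2)).
    by rewrite w'E P'E /dot /=; ring.
  by rewrite H1 mulr1 /dot /= xE yE; ring.
have qE : b * w'.1 ^+ 2 + a * w'.2 ^+ 2 =
  q + 2 * mu * (dot (x, y) (w1, w2) + t * dot (w1, w2) (w1, w2)) - mu ^+ 2.
  transitivity (q + 2 * mu * (a * n1 * w1 + b * n2 * w2)
    - mu ^+ 2 * (a * n1 ^+ 2 + b * n2 ^+ 2)
    + mu * (a + b) * (mu * (n1 ^+ 2 + n2 ^+ 2) - 2 * (w1 * n1 + w2 * n2))).
    by rewrite w'E /q /=; ring.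
  by rewrite muE H1 subrr mulr0 addr0 mulr1 /dot /= xE yE; ring.
have Eu : lax_u a b P' = u'.
  rewrite /u' /lax_u /lax_v /lax_w -/c -/q.
  transitivity (1 - (a + b - dot P' P')%:P * 'X
     - (t%:P * (2 * c + t * q)%:P) * 'X^2); last first.
    by rewrite P'E /dot /= xE yE; ring.
  by rewrite tq subrr mulr0 mul0r subr0.
split=> //; split=> //.
- rewrite -Eu /M /lax_u /lax_v /lax_w cons dP' -/c -/q.
  set p := dot (x, y) _; set r := dot (w1, w2) _; set U := a + b - _ in mU *.
  transitivity ((- c - mu * U)%:P * 'X^2 - (p + t * r - mu)%:P * 'X).
    by rewrite mU; congr (_%:P * _ - _); ring.
  have -> : - c = c + t * q by rewrite tq; ring.
  by ring.
- rewrite -Eu /M /lax_u /lax_v /lax_w norm qE -/c -/q.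
  set p := dot (x, y) _; set r := dot (w1, w2) _; set U := a + b - _ in mU *.
  (* The conjugation produces an s^3 term, which vanishes since mu U = - 2 c and c + t q = - c. *)
  transitivity ((q + 2 * mu * (p + t * r) - mu ^+ 2)%:P * 'X^2 - r%:P * 'X
    + (mu * (mu * U - 2 * (c + t * q)))%:P * 'X^3); last by ring.
  have -> : mu * U - 2 * (c + t * q) = 0 by rewrite mU tq; ring.
  by rewrite mulr0 mul0r addr0.
Qed.

(** * The symmetry realized by a Pell solution *)

(* At s = 1 / a the kernel of the Lax matrix is spanned by (x, w.1), which the
   step matrices carry along; this gives the invariants in the last clause. *)
Definition descent_state (R : realType) (a b : R) (P0 w0 : R * R) (f : {poly R})
    (m : nat) (P w : R * R) : Prop :=
  exists e11 e12 e21 e22 : {poly R},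
  [/\ w != 0, joachimsthal a b P w = joachimsthal a b P0 w0,
      intertwines (lax_v a b P0 w0) (lax_w a b w0)
        (lax_v a b P w) (lax_u a b P) (lax_w a b w) e11 e12 e21 e22,
      [/\ (size e11 <= m.+1)%N, (size e12 <= m.+1)%N, (size e21 <= m.+2)%N,
          (size e22 <= m.+2)%N & e22`_m.+1 != 0] &
      [/\ e11.[0] = f.[0],
          e11.[a^-1] * P.1 + e12.[a^-1] * w.1 = f.[a^-1] * P0.1 &
          e11.[b^-1] * P.2 + e12.[b^-1] * w.2 = f.[b^-1] * P0.2]].

(** At m = 0 the bounce leaves the constant first row (f(0), 0), so the invariants at 1/a and 1/b
    become the final equations. *)
Lemma descent_state_step (R : realType) (a b t : R) (P0 w0 P w : R * R)
    (f : {poly R}) (m : nat) :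
  0 < a -> 0 < b -> t != 0 -> on_ellipse a b P ->
  let P' := P + scale t w in
  on_ellipse a b P' -> descent_state a b P0 w0 f m P w ->
  ((0 < m)%N -> descent_state a b P0 w0 f m.-1 P'
                  (reflect_vector (ellipse_normal a b P') w)) /\
  (m = 0%N -> f.[0] * P'.1 = f.[a^-1] * P0.1 /\ f.[0] * P'.2 = f.[b^-1] * P0.2).
Proof.
move=> a0 b0 t0 HP P' HP' [e11 [e12 [e21 [e22 [w00 cP int [s11 s12 s21 s22 top]]]]]].
move=> [H0 Ha Hb].
have [cons norm [Eu Ev Ew]] := billiard_step a0 b0 w00 t0 HP HP'.
have [tq c0] := chord_joachimsthal a0 b0 w00 t0 HP HP'.
set mu := 2 * _ / _ in Ev Ew; set w' := reflect_vector _ _ in cons norm Ev Ew *.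
have int' := intertwines_step t%:P (mu%:P * 'X) int.
rewrite -Eu in Ev Ew; rewrite /= -Eu -Ev -Ew in int'.
have two0 : 2 != 0 :> R by rewrite pnatr_eq0.
have tq' : t * (lax_w a b w)`_2 = - (2 * joachimsthal a b P w).
  by rewrite coef2_quadratic.
have vP : (lax_v a b P w)`_2 = joachimsthal a b P w by exact: coef2_quadratic.
have vP0 : (lax_v a b P0 w0)`_2 = joachimsthal a b P w.
  by rewrite cP; exact: coef2_quadratic.
have vP' : (lax_v a b P' w')`_2 = joachimsthal a b P w.
  by rewrite -cons; exact: coef2_quadratic.
have [] := intertwines_descent two0 c0 tq' (size_quadratic _ _) vP0
  (size_quadratic _ _) (size_quadratic _ _) vP
  (size_quadratic _ _) (size_quadratic _ _) vP' (size_quadratic _ _)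
  int int' s11 s12 s21 s22 top.
set h1 := e12 - _; set h2 := e22 - _; set g1 := e11 + _; set g2 := e21 + _.
move=> sg1 sh1 sg2 sh2 [top' sg1'].
have w'0 : w' != 0.
  apply: contraTneq (dot_gt0 w00) => w'0; rewrite -norm w'0 /dot /= !mul0r addr0.
  by rewrite ltxx.
have H0' : g1.[0] = f.[0] by rewrite -H0 /g1 !hornerE ?(mulr0, mul0r, addr0).
(* The normal has first coordinate P'.1 / a, so the terms in mu cancel at s = 1/a; those in t cancel
   as well. *)
have Ha' : g1.[a^-1] * P'.1 + h1.[a^-1] * w'.1 = f.[a^-1] * P0.1.
  by rewrite -Ha /g1 /h1 !hornerE /= -/mu; ring.
have Hb' : g1.[b^-1] * P'.2 + h1.[b^-1] * w'.2 = f.[b^-1] * P0.2.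
  by rewrite -Hb /g1 /h1 !hornerE /= -/mu; ring.
split=> [m0|m0].
  exists g1, h1, g2, h2; rewrite prednK //; split=> //; first by rewrite cons cP.
  by split=> //; exact: sg1'.
move: sg1 sh1; rewrite m0 leqn0 size_poly_eq0 => /size1_polyC Eg /eqP h10.
move: H0' Ha' Hb'; by rewrite Eg h10 !hornerE ?(mul0r, addr0) => ->; split.
Qed.

(* E = f + h L0, where h is a constant multiple of g, has determinant 1 and
   commutes with L0; the constant makes the leading terms cancel in e11. *)
Lemma descent_state_init (R : realType) (a b l : R) (P w : R * R) (f g : {poly R})
    (m : nat) :
  a != 0 -> b != 0 -> l != 0 -> w != 0 -> on_ellipse a b P ->
  joachimsthal a b P w != 0 ->
  a * b * l * dot w w = joachimsthal a b P w ^+ 2 ->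
  size f = m.+2 -> size g = m -> pell_equation a b l f g ->
  descent_state a b P w f m P w.
Proof.
move=> a0 b0 l0 w0 HP c0 HJ sf sg E.
have LD := lax_det a0 b0 l0 HP HJ.
set c := joachimsthal a b P w in c0 HJ LD *.
have m0 : (0 < m)%N.
  rewrite -sg lt0n size_poly_eq0; apply/eqP => g0.
  move: E; rewrite /pell_equation g0 expr0n mulr0 subr0 => /(congr1 (fun p : {poly R} => size p)).
  have f0 : f != 0 by rewrite -size_poly_eq0 sf.
  by rewrite size_poly1 expr2 size_mul // sf; lia.
set V := lax_v a b P w in LD *; set U := lax_u a b P in LD *.
set W := lax_w a b w in LD *.
pose F := f`_m.+1; pose G := g`_m.-1.
have F0 : F != 0 by rewrite /F -[m.+1]/(m.+2.-1) -sf -lead_coefE lead_coef_eq0 -size_poly_eq0 sf.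
have G0 : G != 0 by rewrite /G -{1}sg -lead_coefE lead_coef_eq0 -size_poly_gt0 sg.
have FG : F ^+ 2 = G ^+ 2.
  have sQ : (size (pell_quartic a b l) <= 5)%N by rewrite pell_quarticE size_prod_XsubC.
  have Q4 : (pell_quartic a b l)`_4 = 1.
    have := monic_prod_XsubC [:: 0; a^-1; b^-1; l^-1] xpredT id.
    by rewrite -pell_quarticE => /monicP; rewrite lead_coefE pell_quarticE size_prod_XsubC.
  have sg' : (size g <= m.-1.+1)%N by rewrite prednK // sg.
  have sgg : (size (g * g)%R <= (m.-1 + m.-1).+1)%N.
    by rewrite (leq_trans (size_polyMleq _ _)) // sg; lia.
  have sf' : (size f <= m.+2)%N by rewrite sf.
  have := congr1 (fun p : {poly R} => p`_(m.+1 + m.+1)) E.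
  rewrite /= coefB !expr2 (coefM_top sf' sf') //.
  rewrite (coefM_top sQ sgg); last by lia.
  rewrite (coefM_top sg' sg') // Q4 mul1r coef1 addnS /= -/F -/G.
  by move/eqP; rewrite subr_eq0 => /eqP ->.
(* This constant gives [h * V] the top coefficient -F, which cancels in [f + h * V] and doubles in
   [f - h * V]. As F^2 = G^2, also k^2 c^2 = 1, which yields determinant 1. *)
pose k := - (F / (G * c)); pose h := k%:P * g.
have kGc : k * G * c = - F by rewrite /k; field; rewrite G0 c0.
have k2 : k ^+ 2 * c ^+ 2 = 1.
  by rewrite /k sqrrN exprMn exprVn exprMn FG; field; rewrite G0 c0.
have sh : (size h <= m.-1.+1)%N.
  by rewrite prednK // /h mul_polyC (leq_trans (size_scale_leq _ _)) // sg.
have hm : h`_m.-1 * c = - F by rewrite /h coefCM kGc.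
have sV : (size V <= 3)%N by exact: size_quadratic.
have sW : (size W <= 3)%N by exact: size_quadratic.
have sU : (size U <= 2)%N by exact: size_lax_u.
have V2 : V`_2 = c by exact: coef2_quadratic.
have szM (p : {poly R}) i : (size p <= i.+1)%N -> (size (h * p)%R <= m + i)%N.
  move=> sp; rewrite (leq_trans (size_polyMleq _ _)) //.
  by move: sh sp; rewrite prednK //; move: (size h) (size p) => x y; lia.
exists (f + h * V), (h * U), (h * W), (f - h * V).
have sf' : (size f <= m.+2)%N by rewrite sf.
have shV : (size (h * V)%R <= m.+2)%N by rewrite -addn2 szM.
have hV : (h * V)`_m.+1 = - F.
  by rewrite (coefM_top sh sV) ?V2 ?hm // addn2 prednK.
split=> //.
- split; rewrite -?/V -?/U -?/W; try by ring.
  transitivity (f ^+ 2 - h ^+ 2 * (V ^+ 2 + U * W)); first by ring.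
  rewrite LD -[RHS]E; congr (_ - _).
  transitivity ((k ^+ 2 * c ^+ 2)%:P * (pell_quartic a b l * g ^+ 2)).
    by rewrite /h; ring.
  by rewrite k2 mul1r.
- split.
  + apply: size_coef_eq0; last by rewrite coefD hV subrr.
    by rewrite (leq_trans (size_polyD _ _)) // geq_max sf' shV.
  + by rewrite -addn1 szM.
  + by rewrite -addn2 szM.
  + by rewrite (leq_trans (size_polyD _ _)) // size_polyN geq_max sf' shV.
  + by rewrite coefB hV opprK -mulr2n mulrn_eq0 negb_or F0.
move: (HP) => /(on_ellipseE _ a0 b0) HP'.
split.
- rewrite hornerD hornerM /V /lax_v hornerD hornerN !hornerM !hornerX.
  by rewrite /= !mulr0 subr0 mulr0 addr0.
- transitivity (f.[a^-1] * P.1 + h.[a^-1] * (V.[a^-1] * P.1 + U.[a^-1] * w.1)).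
    by rewrite hornerD !hornerM; ring.
  have -> : V.[a^-1] * P.1 + U.[a^-1] * w.1 =
      w.1 / a ^+ 2 * (b * P.1 ^+ 2 + a * P.2 ^+ 2 - a * b).
    rewrite /V /U /lax_v /lax_u !hornerE /= /c /joachimsthal /dot; field; exact: a0.
  by rewrite HP' subrr !mulr0 addr0.
- transitivity (f.[b^-1] * P.2 + h.[b^-1] * (V.[b^-1] * P.2 + U.[b^-1] * w.2)).
    by rewrite hornerD !hornerM; ring.
  have -> : V.[b^-1] * P.2 + U.[b^-1] * w.2 =
      w.2 / b ^+ 2 * (b * P.1 ^+ 2 + a * P.2 ^+ 2 - a * b).
    rewrite /V /U /lax_v /lax_u !hornerE /= /c /joachimsthal /dot; field; exact: b0.
  by rewrite HP' subrr !mulr0 addr0.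
Qed.

Lemma reflect_scale (R : realType) (w v : R * R) (t : R) :
  reflect_vector w (scale t v) = scale t (reflect_vector w v).
Proof.
case: w v => [w1 w2] [v1 v2]; rewrite /reflect_vector /scale /dot /=.
by congr pair; rewrite /=; ring.
Qed.

(** The descent starts at m = n = deg f - 1 and loses one degree per bounce, so the segment ending
    at X_(n+1) is the one handled at m = 0. *)
Lemma trajectory_shift (R : realType) (a b l : R) (n : nat) (f g : {poly R})
    (X : nat -> R * R) :
  0 < a -> 0 < b -> l != 0 -> l != a -> l != b ->
  size f = n.+2 -> size g = n -> pell_equation a b l f g ->
  billiard_trajectory a b X -> has_caustic a b l X ->
  f.[0] * (X n.+1).1 = f.[a^-1] * (X 0%N).1 /\
  f.[0] * (X n.+1).2 = f.[b^-1] * (X 0%N).2.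
Proof.
move=> a0 b0 l0 la lb sf sg E [onE neq refl] caus.
have an0 : a != 0 by rewrite gt_eqF.
have bn0 : b != 0 by rewrite gt_eqF.
pose w := X 1%N - X 0%N.
have w0 : w != 0 by rewrite subr_eq0; apply/eqP.
have X1 : X 1%N = X 0%N + scale 1 w.
  by rewrite /scale !mul1r -surjective_pairing addrC subrK.
have HJ := tangent_joachimsthal an0 bn0 la lb (neq 0%N) (onE 0%N) (caus 0%N).
have on1 : on_ellipse a b (X 0%N + scale 1 w) by rewrite -X1.
have [_ c0] := chord_joachimsthal a0 b0 w0 (oner_neq0 R) (onE 0%N) on1.
have init := descent_state_init an0 bn0 l0 w0 (onE 0%N) c0 HJ sf sg E.
(* The direction v is reflected but never rescaled, which keeps its Joachimsthal value; the actual
   chord is t v. *)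
have key k : (k <= n)%N -> exists v t, [/\ t != 0, X k.+1 = X k + scale t v &
    descent_state a b (X 0%N) w f (n - k) (X k) v].
  elim: k => [_|k IH kn].
    by exists w, 1; rewrite oner_neq0 subn0.
  have [v [t [t0 Xk st]]] := IH (ltnW kn).
  have onE' := onE k.+1; rewrite Xk in onE'.
  have [/(_ _) st' _] := descent_state_step a0 b0 t0 (onE k) onE' st.
  rewrite subn_gt0 kn -Xk -subnS in st'.
  have [c c0' Ec] := refl k.
  have D : X k.+1 - X k = scale t v by rewrite Xk addrC addKr.
  exists (reflect_vector (ellipse_normal a b (X k.+1)) v), (c * t); split.
  - by rewrite mulf_neq0 // gt_eqF.
  - apply/eqP; rewrite addrC -subr_eq Ec D reflect_scale.
    by rewrite /scale /= !mulrA.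
  - exact: st'.
have [v [t [t0 Xn st]]] := key n (leqnn n).
have onE' := onE n.+1; rewrite Xn in onE'.
have [_] := descent_state_step a0 b0 t0 (onE n) onE' st.
by rewrite subnn -Xn; apply.
Qed.

Lemma pell_value_root (R : realType) (a b l z : R) (f g : {poly R}) :
  pell_equation a b l f g -> (pell_quartic a b l).[z] = 0 -> f.[z] ^+ 2 = 1.
Proof.
move=> /(congr1 (horner^~ z)) /= + Q0.
by rewrite hornerD hornerN (hornerM (pell_quartic a b l)) Q0 mul0r subr0 hornerC
  horner_exp.
Qed.

Lemma trajectory_symmetry (R : realType) (a b l : R) (n : nat) (f g : {poly R})
    (X : nat -> R * R) (k : nat) :
  0 < a -> 0 < b -> l != 0 -> l != a -> l != b ->
  size f = n.+2 -> size g = n -> pell_equation a b l f g ->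
  billiard_trajectory a b X -> has_caustic a b l X ->
  X (k + n.+1)%N = (f.[0] * f.[a^-1] * (X k).1, f.[0] * f.[b^-1] * (X k).2).
Proof.
move=> a0 b0 l0 la lb sf sg E [onE neq refl] caus.
have f0 : f.[0] ^+ 2 = 1.
  by apply: (pell_value_root E); rewrite /pell_quartic !hornerE.
have := @trajectory_shift _ a b l n f g (fun i => X (k + i)%N) a0 b0 l0 la lb sf sg E.
rewrite addn0 => -[||e1 e2].
- by split=> i; rewrite ?addnS; [exact: onE|exact: neq|exact: refl].
- by move=> i; rewrite addnS; exact: caus.
rewrite [LHS]surjective_pairing; congr pair.
  by rewrite -mulrA -e1 mulrA -expr2 f0 mul1r.
by rewrite -mulrA -e2 mulrA -expr2 f0 mul1r.
Qed.

(** * Confocal conics through a point *)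

Lemma on_confocal_root (R : realType) (a b l : R) (P : R * R) :
  b < a -> (a - l) * (b - l) = P.1 ^+ 2 * (b - l) + P.2 ^+ 2 * (a - l) ->
  on_confocal a b l P.
Proof.
move=> ba; rewrite /on_confocal.
have ab0 : a - b != 0 by rewrite subr_eq0 gt_eqF.
have ba0 : b - a != 0 by rewrite subr_eq0 lt_eqF.
case: eqVneq => [->|la].
  rewrite subrr mul0r mulr0 addr0 => /esym/eqP.
  by rewrite mulf_eq0 (negbTE ba0) orbF sqrf_eq0 => /eqP.
case: eqVneq => [->|lb].
  rewrite subrr !mulr0 add0r => /esym/eqP.
  by rewrite mulf_eq0 (negbTE ab0) orbF sqrf_eq0 => /eqP.
have al : a - l != 0 by rewrite subr_eq0 eq_sym.
have bl : b - l != 0 by rewrite subr_eq0 eq_sym.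
move=> E; have -> : P.1 ^+ 2 / (a - l) + P.2 ^+ 2 / (b - l) =
  (P.1 ^+ 2 * (b - l) + P.2 ^+ 2 * (a - l)) / ((a - l) * (b - l)).
  by field; rewrite al bl.
by rewrite -E divff ?mulf_neq0.
Qed.

(** The coordinates are the roots l of (a - l)(b - l) = x^2 (b - l) + y^2 (a - l). Its discriminant
    [D] is written as a sum of two nonnegative terms that vanish together only at the foci. *)
Lemma elliptic_coordinates_exist (R : realType) (a b : R) (P : R * R) :
  b < a -> ~ (P.1 ^+ 2 = a - b /\ P.2 = 0) ->
  exists l1 l2, elliptic_coordinates a b P l1 l2.
Proof.
move=> ba nf; pose x := P.1; pose y := P.2.
pose D := (x ^+ 2 + y ^+ 2 - (a - b)) ^+ 2 + 4 * (a - b) * y ^+ 2.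
have ab : 0 < a - b by rewrite subr_gt0.
have D0 : 0 < D.
  have y2 : 0 <= 4 * (a - b) * y ^+ 2.
    by rewrite mulr_ge0 ?sqr_ge0 // mulr_ge0 ?ler0n // ltW.
  rewrite lt0r addr_ge0 ?sqr_ge0 // andbT paddr_eq0 ?sqr_ge0 //.
  apply/negP => /andP[]; rewrite sqrf_eq0 mulf_eq0 (gt_eqF (mulr_gt0 _ ab)) //=.
  rewrite sqrf_eq0 => e1 /eqP e2; apply: nf; split=> //.
  by move/eqP: e1; rewrite e2 -/x => e1; lra.
have s0 : 0 < Num.sqrt D by rewrite sqrtr_gt0.
have s2 : Num.sqrt D ^+ 2 = D by rewrite sqr_sqrtr // ltW.
set s := Num.sqrt D in s0 s2.
exists ((a + b - x ^+ 2 - y ^+ 2 - s) / 2), ((a + b - x ^+ 2 - y ^+ 2 + s) / 2).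
split; first by rewrite ltr_pM2r ?invr_gt0 ?ltr0n // ltrD2l; lra.
- apply: on_confocal_root => //; apply/eqP; rewrite -subr_eq0 -/x -/y; apply/eqP.
  transitivity ((s ^+ 2 - D) / 4); first by rewrite /D; field.
  by rewrite s2 subrr mul0r.
- apply: on_confocal_root => //; apply/eqP; rewrite -subr_eq0 -/x -/y; apply/eqP.
  transitivity ((s ^+ 2 - D) / 4); first by rewrite /D; field.
  by rewrite s2 subrr mul0r.
Qed.

Lemma on_confocal_sqr (R : realType) (a b l : R) (P Q : R * R) :
  Q.1 ^+ 2 = P.1 ^+ 2 -> Q.2 ^+ 2 = P.2 ^+ 2 ->
  on_confocal a b l P -> on_confocal a b l Q.
Proof.
move=> e1 e2; rewrite /on_confocal e1 e2.
case: ifP => _; last case: ifP => _ // P0.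
  by move=> P0; apply/eqP; rewrite -sqrf_eq0 e1 P0 expr0n.
by apply/eqP; rewrite -sqrf_eq0 e2 P0 expr0n.
Qed.

(** For xi = x / (a - l) and eta = y / (b - l), a tangent through a focus would satisfy (b - l)(xi^2
    + eta^2) = 0: it would be isotropic, hence not real. *)
Lemma tangent_not_focus (R : realType) (a b l t : R) (A B : R * R) :
  l != a -> l != b -> tangent_to_confocal a b l A B ->
  let P := A + scale t (B - A) in ~ (P.1 ^+ 2 = a - b /\ P.2 = 0).
Proof.
move=> la lb [x [y [z [nz Hz HA HB]]]] P [P1 P2].
have al : a - l != 0 by rewrite subr_eq0 eq_sym.
have bl : b - l != 0 by rewrite subr_eq0 eq_sym.
have HP : P.1 * x / (a - l) + P.2 * y / (b - l) = z.
  transitivity ((1 - t) * (A.1 * x / (a - l) + A.2 * y / (b - l)) +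
                t * (B.1 * x / (a - l) + B.2 * y / (b - l))).
    by rewrite /P /=; ring.
  by rewrite HA HB; ring.
move: HP; rewrite P2 !mul0r addr0 => HP.
have E : (y * (a - l)) ^+ 2 + (x * (b - l)) ^+ 2 = 0.
  have : ((a - b) * (x / (a - l)) ^+ 2) = x ^+ 2 / (a - l) + y ^+ 2 / (b - l).
    by rewrite Hz -HP -P1; ring.
  move=> e; apply: (mulfI (invr_neq0 bl)); rewrite mulr0.
  transitivity ((x ^+ 2 / (a - l) + y ^+ 2 / (b - l) - (a - b) * (x / (a - l)) ^+ 2) * (a - l) ^+ 2).
    by field; rewrite al bl.
  by rewrite e subrr mul0r.
move/eqP: E; rewrite paddr_eq0 ?sqr_ge0 // !sqrf_eq0 !mulf_eq0 (negbTE al) (negbTE bl).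
rewrite !orbF => /andP[/eqP y0 /eqP x0]; apply: nz; split=> //.
by rewrite -HP x0 !mulr0 mul0r.
Qed.

(** * Elliptic coordinates and existence of trajectories *)

(** The signs relating vertices N bounces apart pass to the moving point by linearity, and confocal
    conics depend only on the squares of the coordinates. *)
Lemma trajectory_elliptic_periodic (R : realType) (a b l : R) (n : nat)
    (f g : {poly R}) (X : nat -> R * R) :
  0 < b -> b < a -> l != 0 -> l != a -> l != b ->
  size f = n.+2 -> size g = n -> pell_equation a b l f g ->
  billiard_trajectory a b X -> has_caustic a b l X ->
  elliptic_periodic a b n.+1 X.
Proof.
move=> b0 ba l0 la lb sf sg E bX cX k t _.
have a0 := lt_trans b0 ba.
have [l1 [l2 H]] :=
  elliptic_coordinates_exist ba (@tangent_not_focus _ _ _ _ t _ _ la lb (cX k)).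
exists l1, l2; split=> //.
have sq z : (pell_quartic a b l).[z] = 0 -> f.[z] ^+ 2 = 1 by exact: pell_value_root E.
have f0 : f.[0] ^+ 2 = 1 by apply: sq; rewrite /pell_quartic !hornerE.
have fa : f.[a^-1] ^+ 2 = 1 by apply: sq; rewrite /pell_quartic !hornerE subrr !(mulr0, mul0r).
have fb : f.[b^-1] ^+ 2 = 1 by apply: sq; rewrite /pell_quartic !hornerE subrr !(mulr0, mul0r).
have sym j := trajectory_symmetry j a0 b0 l0 la lb sf sg E bX cX.
have E1 : (moving_point X (k + n.+1) t).1 = f.[0] * f.[a^-1] * (moving_point X k t).1.
  by rewrite /moving_point -addSn !sym /=; ring.
have E2 : (moving_point X (k + n.+1) t).2 = f.[0] * f.[b^-1] * (moving_point X k t).2.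
  by rewrite /moving_point -addSn !sym /=; ring.
have S1 : (moving_point X (k + n.+1) t).1 ^+ 2 = (moving_point X k t).1 ^+ 2.
  by rewrite E1 !exprMn f0 fa !mul1r.
have S2 : (moving_point X (k + n.+1) t).2 ^+ 2 = (moving_point X k t).2 ^+ 2.
  by rewrite E2 !exprMn f0 fb !mul1r.
by case: H => l12 c1 c2; split=> //; apply: on_confocal_sqr S1 S2 _.
Qed.

(** * Trajectories with a prescribed caustic *)

Lemma joachimsthal_tangent (R : realType) (a b l t : R) (P w : R * R) :
  a != 0 -> b != 0 -> l != a -> l != b -> w != 0 -> on_ellipse a b P ->
  a * b * l * dot w w = joachimsthal a b P w ^+ 2 ->
  tangent_to_confocal a b l P (P + scale t w).
Proof.
move=> a0 b0 la lb w0 /(on_ellipseE _ a0 b0).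
have al : a - l != 0 by rewrite subr_eq0 eq_sym.
have bl : b - l != 0 by rewrite subr_eq0 eq_sym.
case: P w w0 => [x y] [w1 w2] w0 /= HP HJ.
(* The tangency point for which (x / (a - l), y / (b - l)) is the normal (-w2, w1) of the line;
   passage through P determines z. *)
exists (- (a - l) * w2), ((b - l) * w1), (y * w1 - x * w2); split=> /=.
- case=> /eqP; rewrite mulf_eq0 oppr_eq0 (negbTE al) => /eqP e2 /eqP.
  by rewrite mulf_eq0 (negbTE bl) => /eqP e1 _; move: w0; rewrite e1 e2 eqxx.
- have -> : (- (a - l) * w2) ^+ 2 / (a - l) + ((b - l) * w1) ^+ 2 / (b - l) =
    (a - l) * w2 ^+ 2 + (b - l) * w1 ^+ 2 by field; rewrite al bl.
  apply: (mulfI (mulf_neq0 a0 b0)).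
  transitivity (a * b * (a * w2 ^+ 2 + b * w1 ^+ 2)
     - a * b * l * dot (w1, w2) (w1, w2)); first by rewrite /dot /=; ring.
  rewrite HJ /joachimsthal /=.
  transitivity (a * b * (y * w1 - x * w2) ^+ 2 +
    (a * b - (b * x ^+ 2 + a * y ^+ 2)) * (a * w2 ^+ 2 + b * w1 ^+ 2)); first by ring.
  by rewrite HP subrr mul0r addr0.
- by field; rewrite al bl.
- by field; rewrite al bl.
Qed.

Definition chord_time (R : realType) (a b : R) (P w : R * R) : R :=
  - (2 * joachimsthal a b P w) / (b * w.1 ^+ 2 + a * w.2 ^+ 2).

(** The state is a point with its outgoing direction, never rescaled, so that [dot] and
    [joachimsthal] are conserved. *)
Definition billiard_map (R : realType) (a b : R) (s : (R * R) * (R * R)) :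
    (R * R) * (R * R) :=
  let P' := s.1 + scale (chord_time a b s.1 s.2) s.2 in
  (P', reflect_vector (ellipse_normal a b P') s.2).

Lemma on_ellipse_chord (R : realType) (a b : R) (P w : R * R) :
  0 < a -> 0 < b -> w != 0 -> on_ellipse a b P ->
  on_ellipse a b (P + scale (chord_time a b P w) w).
Proof.
move=> a0 b0 w0; have q0 := quadratic_form_gt0 a0 b0 w0.
have an0 : a != 0 by rewrite gt_eqF.
have bn0 : b != 0 by rewrite gt_eqF.
rewrite !on_ellipseE // => HP.
have tq : chord_time a b P w * (b * w.1 ^+ 2 + a * w.2 ^+ 2) = - (2 * joachimsthal a b P w).
  by rewrite /chord_time divfK // gt_eqF.
set t := chord_time a b P w in tq *.
transitivity (b * P.1 ^+ 2 + a * P.2 ^+ 2 +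
  t * (2 * joachimsthal a b P w + t * (b * w.1 ^+ 2 + a * w.2 ^+ 2))).
  by rewrite /joachimsthal /=; ring.
by rewrite tq subrr mulr0 addr0.
Qed.

(** A negative Joachimsthal value means that w0 points into the ellipse. Its conservation makes all
    chord times positive, and with the conserved norm it keeps every segment tangent to the
    caustic. *)
Lemma billiard_trajectory_exists (R : realType) (a b l : R) (P0 w0 : R * R) :
  0 < a -> 0 < b -> l != a -> l != b -> w0 != 0 -> on_ellipse a b P0 ->
  joachimsthal a b P0 w0 < 0 ->
  a * b * l * dot w0 w0 = joachimsthal a b P0 w0 ^+ 2 ->
  exists X, [/\ billiard_trajectory a b X, has_caustic a b l X, X 0%N = P0 &
    exists2 t, t != 0 & X 1%N = P0 + scale t w0].
Proof.
move=> a0 b0 la lb w00 HP0 J0 HJ.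
have an0 : a != 0 by rewrite gt_eqF.
have bn0 : b != 0 by rewrite gt_eqF.
pose s k := iter k (billiard_map a b) (P0, w0).
pose time k := chord_time a b (s k).1 (s k).2.
have timeP k : (s k).2 != 0 -> joachimsthal a b (s k).1 (s k).2 = joachimsthal a b P0 w0 ->
    0 < time k.
  move=> w0' J; rewrite /time /chord_time J divr_gt0 ?quadratic_form_gt0 //.
  by rewrite oppr_gt0 pmulr_rlt0 ?ltr0n.
have inv k : [/\ on_ellipse a b (s k).1, (s k).2 != 0,
    joachimsthal a b (s k).1 (s k).2 = joachimsthal a b P0 w0 &
    dot (s k).2 (s k).2 = dot w0 w0].
  elim: k => [//|k [onP w0' J N]].
  have t0 := lt0r_neq0 (timeP k w0' J).
  have onP' := on_ellipse_chord a0 b0 w0' onP.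
  have [J' N' _] := billiard_step a0 b0 w0' t0 onP onP'.
  split=> //; [|by rewrite -J|by rewrite -N].
  apply: contraTneq (dot_gt0 w00) => e.
  by rewrite -N -N' -[reflect_vector _ _]/(s k.+1).2 e /dot /= !mul0r addr0 ltxx.
have step k : (s k.+1).1 = (s k).1 + scale (time k) (s k).2 by [].
have diff k : (s k.+1).1 - (s k).1 = scale (time k) (s k).2.
  by rewrite step addrC addKr.
exists (fun k => (s k).1); split=> //; last 1 first.
- exists (time 0%N) => //; have [_ ? ? _] := inv 0%N; exact/lt0r_neq0/timeP.
- split=> k.
  + by have [] := inv k.
  + move=> /eqP; rewrite -subr_eq0 diff => /eqP e; have [_ w0' J _] := inv k.
    have t0 := lt0r_neq0 (timeP k w0' J); case/eqP: w0'.
    have /(mulfI t0) e1 : time k * (s k).2.1 = time k * 0.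
      by rewrite mulr0; exact: (congr1 fst e).
    have /(mulfI t0) e2 : time k * (s k).2.2 = time k * 0.
      by rewrite mulr0; exact: (congr1 snd e).
    by rewrite [LHS]surjective_pairing e1 e2.
  + have [_ w0' J _] := inv k; have [_ w0'' J' _] := inv k.+1.
    have t0 := timeP k w0' J; have t1 := timeP k.+1 w0'' J'.
    exists (time k.+1 / time k); first exact: divr_gt0.
    rewrite !diff reflect_scale -[in LHS](divfK (lt0r_neq0 t0) (time k.+1)).
    by congr pair; rewrite /scale /= !mulrA.
- move=> k; rewrite step; have [onP w0' J N] := inv k.
  by apply: joachimsthal_tangent => //; rewrite N HJ J.
Qed.

Theorem theorem3p7 (R : realType) (a b l0 : R) (n : nat) (ph qh : {poly R})
    (hb : 0 < b) (hab : b < a)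
    (hl0 : 0 < l0 < b \/ b < l0 < a)
    (hn : (1 <= n)%N)
    (hph : has_degree ph (2 * n)) (hqh : has_degree qh (2 * n - 2))
    (hpell : pell_equation a b l0 ph qh) :
  exists p q S1 S2 : {poly R},
    [/\ pell_splitting a b l0 n p q S1 S2,
        forall p' q' T1 T2 : {poly R},
          pell_splitting a b l0 n p' q' T1 T2 ->
          same_splitting p q S1 S2 p' q' T1 T2,
        forall X : nat -> R * R,
          billiard_trajectory a b X -> has_caustic a b l0 X ->
          elliptic_periodic a b (2 * n) X &
        (forall X : nat -> R * R,
          billiard_trajectory a b X -> has_caustic a b l0 X ->
          periodic (2 * n) X) <-> S1 = 1].
Proof.
have ha := lt_trans hb hab.
have lpos : 0 < l0 by move: hl0 hb; lra.
have lta : l0 < a by move: hl0 hab; lra.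
have l0n : l0 != 0 by rewrite gt_eqF.
have la : l0 != a by rewrite lt_eqF.
have lb : l0 != b by case: hl0 => /andP[h1 h2]; [rewrite lt_eqF|rewrite gt_eqF].
have urs := uniq_pell_roots hb hab hl0.
have [p [q [S1 [S2 sp]]]] := pell_splitting_exists urs hn hph hqh hpell.
have [m Em] : exists m, (2 * n)%N = m.+1 by exists (2 * n - 1)%N; clear -hn; lia.
have sf : size ph = m.+2 by rewrite -Em.
have sg : size qh = m by rewrite (hqh : size qh = _); clear -Em; lia.
exists p, q, S1, S2; split=> //.
- by move=> p' q' T1 T2; exact: pell_splitting_unique.
- by move=> X bX cX; rewrite Em; apply: trajectory_elliptic_periodic sf sg hpell bX cX.
rewrite (pell_splitting_trivial urs hn sp hph hqh hpell).
have f0 : ph.[0] ^+ 2 = 1.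
  by apply: (pell_value_root hpell); rewrite /pell_quartic !hornerE.
split=> [per|[Ea Eb] X bX cX k]; last first.
  rewrite Em (trajectory_symmetry k ha hb l0n la lb sf sg hpell bX cX) Ea Eb.
  by rewrite -expr2 f0 !mul1r -surjective_pairing.
(* A trajectory detecting both signs: it leaves (0, sqrt b) in the direction (w1, -1). Tangency to
   the caustic reads a b l0 (w1^2 + 1) = a^2 b, whence w1, nonzero because l0 < a. *)
pose w1 := Num.sqrt ((a - l0) / l0).
have w1sq : w1 ^+ 2 = (a - l0) / l0.
  by rewrite sqr_sqrtr // divr_ge0 ?ltW // subr_gt0.
have w10 : w1 != 0 by rewrite gt_eqF // sqrtr_gt0 divr_gt0 // subr_gt0.
have bsq : Num.sqrt b ^+ 2 = b by rewrite sqr_sqrtr // ltW.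
have sb0 : 0 < Num.sqrt b by rewrite sqrtr_gt0.
have J : joachimsthal a b (0, Num.sqrt b) (w1, -1) = - (a * Num.sqrt b).
  by rewrite /joachimsthal /= mulr0 mul0r add0r mulrN1.
have [||||X [bX cX X0 [t t0 X1]]] :=
    @billiard_trajectory_exists R a b l0 (0, Num.sqrt b) (w1, -1) ha hb la lb.
- by apply: contraNneq w10 => -[->].
- by rewrite /on_ellipse /= bsq expr0n mul0r add0r divff // gt_eqF.
- by rewrite J oppr_lt0 mulr_gt0.
- rewrite J sqrrN exprMn bsq /dot /= -!expr2 w1sq; field.
  exact: l0n.
have sym k := trajectory_symmetry k ha hb l0n la lb sf sg hpell bX cX.
have inv x y : x ^+ 2 = 1 -> x * y = 1 -> y = x :> R.
  by move=> x2 xy; rewrite -[y]mul1r -x2 expr2 -mulrA xy mulr1.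
split; apply: inv => //.
(* The abscissa t w1 of [X 1] is nonzero and forces f(0) f(1/a) = 1; the ordinate of [X 0] does the
   same at 1/b. *)
- have := per X bX cX 1%N; rewrite Em sym => /(congr1 fst) /=.
  rewrite X1 /= add0r -[RHS]mul1r => /mulIf -> //.
  by rewrite mulf_neq0.
- have := per X bX cX 0%N; rewrite Em sym => /(congr1 snd) /=.
  by rewrite X0 /= -[RHS]mul1r => /mulIf -> //; rewrite gt_eqF.
Qed.
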